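(* There exists a universal constant $C>4$ with the following property. Let $\Omega\subset\mathbb{R}^2$ be an open bounded simply connected set such that $|\Omega|=\pi$. For every $x_0\in\Omega$, let $f_{x_0}:\Omega\to B_1$ be a holomorphic isomorphism such that $f_{x_0}(x_0)=0$. Then for every $x_0\in\Omega$ $$\frac{1}{|f'_{x_0}(x_0)|}=\left|(f_{x_0}^{-1})'(0)\right|\le \sqrt{1-\frac{1}{C}\,\mathcal{A}(\Omega)^2}.$$
   Context: $\mathbb{R}^2$ is identified with $\mathbb{C}$, $B_1$ is the open unit disc centered at the origin, $'$ denotes the complex derivative, and $|\Omega|$ is the Lebesgue measure of $\Omega$. The holomorphic isomorphism $f_{x_0}$ exists by the Riemann Mapping Theorem (simply connected sets are connected) and is unique up to a rotation. The Fraenkel asymmetry is $\mathcal{A}(\Omega)=\inf\left\{\frac{|\Omega\Delta B|}{|\Omega|}: B \text{ disc with } |B|=|\Omega|\right\}$. *)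

(* Defs.v *)
From HB Require Import structures.
From mathcomp Require Import all_boot all_order all_algebra.
From mathcomp Require Import complex.
From mathcomp Require Import all_classical all_reals all_analysis.

Set Implicit Arguments.
Unset Strict Implicit.
Unset Printing Implicit Defensive.

Import Order.TTheory GRing.Theory Num.Theory.
Import numFieldNormedType.Exports.

Local Open Scope classical_set_scope.
Local Open Scope complex_scope.
Local Open Scope ring_scope.

(* The complex plane with its usual topology: R[i] is a field, and the alias
   ^o makes it a one-dimensional normed space over itself, so that derivatives
   of functions from it to itself are complex derivatives. *)
Notation plane R := (R[i]^o).

(* A disc with complex radius r%:C, because the norm of R[i] is R[i]-valued. *)
Definition disc (R : realType) (c : plane R) (r : R) : set (plane R) :=
  ball c r%:C.

Definition area (R : realType) (A : set (plane R)) : \bar R :=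
  (@lebesgue_measure R \x @lebesgue_measure R)%E
    [set p : R * R | A (p.1 +i* p.2)].

Definition fraenkel_asymmetry (R : realType) (Omega : set (plane R)) : R :=
  inf [set a : R | exists c : plane R, exists r : R,
    [/\ 0 < r, area (disc c r) = area Omega &
        a = fine (area (Omega `+` disc c r)) / fine (area Omega)]].

Definition path_connected (R : realType) (A : set (plane R)) : Prop :=
  forall x y : plane R, A x -> A y -> exists gamma : R -> plane R,
    [/\ {within `[0, 1], continuous gamma}, set_fun `[0, 1] A gamma,
        gamma 0 = x & gamma 1 = y].

(* H (s, t) is the point of parameter t on the s-th loop of the homotopy. *)
Definition null_homotopic (R : realType) (A : set (plane R))
    (gamma : R -> plane R) : Prop :=
  exists H : R * R -> plane R,
    [/\ {within `[0, 1] `*` `[0, 1], continuous H},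
        set_fun (`[0, 1] `*` `[0, 1]) A H,
        forall t : R, t \in `[0, 1] -> H (0, t) = gamma t,
        forall t : R, t \in `[0, 1] -> H (1, t) = gamma 0 &
        forall s : R, s \in `[0, 1] -> H (s, 0) = gamma 0 /\ H (s, 1) = gamma 0].

Definition simply_connected (R : realType) (A : set (plane R)) : Prop :=
  path_connected A /\
  forall gamma : R -> plane R,
    {within `[0, 1], continuous gamma} -> set_fun `[0, 1] A gamma ->
    gamma 0 = gamma 1 -> null_homotopic A gamma.

(* Meant for open A: derivability at z involves the values of f near z. *)
Definition holomorphic_on (R : realType) (A : set (plane R))
    (f : plane R -> plane R) : Prop :=
  forall z, A z -> derivable f z 1.

(* f and g are total functions: only the values of f on A and of g on B
   matter, and there g is the inverse of f. *)
Definition holomorphic_iso (R : realType) (A B : set (plane R))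
    (f g : plane R -> plane R) : Prop :=
  [/\ set_fun A B f, set_fun B A g,
      {in A, cancel f g} /\ {in B, cancel g f},
      holomorphic_on A f & holomorphic_on B g].

(* Main.v *)
Require Import Defs.
From mathcomp Require Import all_boot all_order all_algebra.
From mathcomp Require Import complex.
From mathcomp Require Import all_classical all_reals all_analysis.
From mathcomp Require Import ring lra measurable_realfun.

(* Let g be the inverse of f, a = g'(0) and, on the half-plane Re w < 0,
   G(w) = g(e^w) = x0 + e^w (a + Q(w)).  The claim follows from
     |Omega ∩ B(x0,1)| >= pi - 12 pi t    whenever  1 - |a|^2 <= t^2,  0 < t < 1,
   since then |Omega Δ B(x0,1)| <= 24 pi t.

   Everything rests on one bisection argument, as in Goursat's lemma: a
   superadditive function of rectangles whose lower density is nonnegative at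
   every point is nonnegative.  Applied to boundary integrals it gives Cauchy's
   theorem for merely differentiable functions, hence the circle means of Q
   vanish and N(u) = int_0^{2pi} |Q(u + iy)|^2 dy, a midpoint convex function
   that tends to 0 at -oo, is nondecreasing.  Applied to the inner area of the
   images under G of rectangles, minus a boundary integral, it bounds areas from
   below as soon as |G'|^2 dominates pointwise the corresponding divergence, with
   no change of variables formula.  Two choices are made:
   - |G'|^2 = e^{2u} |a + Q + Q'|^2 >= e^{2u} (|a|^2 + 2 Re conj(a) (Q + Q'))
       + e^{2u} (2 Re conj(Q) (Q + Q') - |Q|^2) yields N <= 2 pi (1 - |a|^2);
   - if G(w) is outside B(x0,1) then |Q(w)| >= (1 - e^u) / e^u, so that
       (1_B(G) + 1) |G'|^2 >= 2 e^{2u} (|a|^2 + 2 Re conj(a) (Q + Q'))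
         - 2 e^u |Q|^2 / (1 - e^u)^2;
     integrated over e^u <= 1 - t, this bounds |Omega ∩ B(x0,1)|. *)

(** Only complex differentiability of the two maps is used, neither power series nor continuity of
    g', so the classical expansion of the area in Taylor coefficients gives way to inequalities
    between fluxes and inner areas. In the coordinate w concentric circles are vertical segments of
    length 2 pi and annuli are rectangles, which suits bisection. The weight 1_B(G) + 1 resolves a
    conflict: the useful lower bound for |G'|^2 is linear in Q + Q', and the linear term integrates
    to nothing only if it has the same coefficient inside and outside B. The extra copy of the area,
    at most pi in total, supplies the linear term outside B at the price of 2 e^{2u} |a|^2, and
    |Q|^2, which is large there, pays for it. The radius 1 - t balances two losses: the ring beyond
    it costs a multiple of t, while the weight e^u / (1 - e^u)^2 integrates to about 1 / t against N
    <= 2 pi (1 - |a|^2) <= 2 pi t^2. The parameter t is kept free, rather than set to the root of 1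
    - |a|^2, so that it stays positive when |a| = 1. *)

Set Implicit Arguments.
Unset Strict Implicit.
Unset Printing Implicit Defensive.
Import Order.TTheory GRing.Theory Num.Theory.
Import numFieldNormedType.Exports.
Local Open Scope classical_set_scope.
Local Open Scope complex_scope.
Local Open Scope ring_scope.

Local Notation Re := complex.Re.
Local Notation Im := complex.Im.
Notation cabs := Normc.normc.
Local Notation "z ^*" := (conjc z) : ring_scope.

(** * Complex numbers *)

Section ComplexModulus.
Context {R : realType}.
Implicit Types (z w : R[i]) (x y : R).

Lemma normE z : `|z| = (cabs z)%:C. Proof. by []. Qed.

Lemma cabs_ge0 z : 0 <= cabs z.
Proof. by case: z => a b; rewrite /= sqrtr_ge0. Qed.

Lemma cabs0 : cabs (0 : R[i]) = 0.
Proof. by rewrite Normc.normc0. Qed.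

Lemma cabs_eq0 z : (cabs z == 0) = (z == 0).
Proof.
by apply/eqP/eqP => [/Normc.eq0_normc|->]; [|exact: cabs0].
Qed.

Lemma cabs_gt0 z : (0 < cabs z) = (z != 0).
Proof. by rewrite lt_def cabs_ge0 andbT cabs_eq0. Qed.

Lemma cabsM z w : cabs (z * w) = cabs z * cabs w.
Proof. exact: Normc.normcM. Qed.

Lemma cabsV z : cabs z^-1 = (cabs z)^-1.
Proof. exact: Normc.normcV. Qed.

Lemma cabsD z w : cabs (z + w) <= cabs z + cabs w.
Proof. by have := ler_normD z w; rewrite !normE -rmorphD lecR. Qed.

Lemma cabsN z : cabs (- z) = cabs z.
Proof. by have /complexI := normrN z. Qed.

Lemma cabsB z w : cabs (z - w) = cabs (w - z).
Proof. by rewrite -cabsN opprB. Qed.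

Lemma cabs_real x : cabs x%:C = `|x|.
Proof. by rewrite /= expr0n /= addr0 sqrtr_sqr. Qed.

Lemma cabs_sqr z : cabs z ^+ 2 = Re z ^+ 2 + Im z ^+ 2.
Proof. by case: z => a b /=; rewrite sqr_sqrtr// addr_ge0// sqr_ge0. Qed.

Lemma Re_le_cabs z : `|Re z| <= cabs z.
Proof.
rewrite -(ler_pXn2r (n := 2))// ?nnegrE ?cabs_ge0 ?normr_ge0//.
by rewrite cabs_sqr real_normK ?num_real// lerDl sqr_ge0.
Qed.

Lemma Im_le_cabs z : `|Im z| <= cabs z.
Proof.
rewrite -(ler_pXn2r (n := 2))// ?nnegrE ?cabs_ge0 ?normr_ge0//.
by rewrite cabs_sqr real_normK ?num_real// lerDr sqr_ge0.
Qed.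

Lemma cabs_le z : cabs z <= `|Re z| + `|Im z|.
Proof.
rewrite -(ler_pXn2r (n := 2))// ?nnegrE ?cabs_ge0 ?addr_ge0//.
rewrite cabs_sqr sqrrD !real_normK ?num_real//.
by rewrite addrAC lerDl mulrn_wge0// mulr_ge0.
Qed.

Lemma cabs_conj z : cabs z^* = cabs z.
Proof. by case: z => a b /=; rewrite sqrrN. Qed.

Lemma cReD z w : Re (z + w) = Re z + Re w. Proof. by case: z; case: w. Qed.
Lemma cImD z w : Im (z + w) = Im z + Im w. Proof. by case: z; case: w. Qed.
Lemma cReN z : Re (- z) = - Re z. Proof. by case: z. Qed.
Lemma cImN z : Im (- z) = - Im z. Proof. by case: z. Qed.
Lemma cReM z w : Re (z * w) = Re z * Re w - Im z * Im w.
Proof. by case: z; case: w. Qed.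
Lemma cImM z w : Im (z * w) = Re z * Im w + Im z * Re w.
Proof. by case: z; case: w. Qed.
Lemma cRe_conj z : Re z^* = Re z. Proof. by case: z. Qed.
Lemma cIm_conj z : Im z^* = - Im z. Proof. by case: z. Qed.
Lemma conjcD z w : (z + w)^* = z^* + w^*. Proof. exact: rmorphD. Qed.
Lemma conjcB z w : (z - w)^* = z^* - w^*. Proof. exact: rmorphB. Qed.
Lemma conjcM z w : (z * w)^* = z^* * w^*. Proof. exact: rmorphM. Qed.

Lemma complex_eq z w : Re z = Re w -> Im z = Im w -> z = w.
Proof. by case: z => a b; case: w => c d /= -> ->. Qed.

End ComplexModulus.

Definition complexReImE {R : realType} :=
  (@cReD R, @cImD R, @cReN R, @cImN R, @cReM R, @cImM R, @cRe_conj R, @cIm_conj R).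

(** * Differentiability in one complex or two real variables *)

Section Differentiability.
Context {R : realType}.
Local Notation C := R[i].
Implicit Types (X Y : C -> R) (F G : C -> C) (c d h : C) (A B : R).

(** Increments are measured by the real modulus [cabs], since the norm of [R[i]] takes values in
    [R[i]]. In [rdiff] the numbers [A] and [B] are the two partial derivatives at [c]. *)
Definition cdiff F c d := forall e : R, 0 < e ->
  exists2 r : R, 0 < r &
    forall h, cabs h < r -> cabs (F (c + h) - F c - d * h) <= e * cabs h.

Definition rdiff X c A B := forall e : R, 0 < e ->
  exists2 r : R, 0 < r & forall h, cabs h < r ->
    `|X (c + h) - X c - (A * Re h + B * Im h)| <= e * cabs h.

Lemma rdiff_lip X c A B : rdiff X c A B ->
  exists2 r : R, 0 < r & forall h, cabs h < r ->
    `|X (c + h) - X c| <= (`|A| + `|B| + 1) * cabs h.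
Proof.
move=> /(_ 1 ltr01)[r r0 Hr]; exists r => // h /Hr; rewrite mul1r => H.
rewrite -(subrK (A * Re h + B * Im h) (X (c + h) - X c)).
rewrite (le_trans (ler_normD _ _))// addrC mulrDl mul1r lerD//.
rewrite (le_trans (ler_normD _ _))// !normrM mulrDl lerD//;
  by rewrite ler_wpM2l// ?Re_le_cabs ?Im_le_cabs.
Qed.

Lemma rdiff_cts X c A B : rdiff X c A B -> forall e : R, 0 < e ->
  exists2 r : R, 0 < r & forall h, cabs h < r -> `|X (c + h) - X c| < e.
Proof.
move=> /rdiff_lip[r r0 Hr] e e0.
set K := _ + 1 in Hr.
have K0 : 0 < K by rewrite /K ltr_wpDl// addr_ge0.
exists (Num.min r (e / K)); first by rewrite lt_min r0 divr_gt0.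
move=> h; rewrite lt_min => /andP[/Hr /le_lt_trans + hK]; apply.
by rewrite mulrC -ltr_pdivlMr.
Qed.

Lemma rdiff_ext X Y c A B : X =1 Y -> rdiff X c A B -> rdiff Y c A B.
Proof.
move=> XY HX e /HX[r r0 Hr]; exists r => // h /Hr.
by rewrite !XY.
Qed.

Lemma rdiff_cst (x : R) c : rdiff (fun=> x) c 0 0.
Proof.
move=> e e0; exists 1 => // h _.
by rewrite subrr !mul0r addr0 subr0 normr0 mulr_ge0 ?cabs_ge0// ltW.
Qed.

Lemma rdiff_Re c : rdiff (fun w => Re w) c 1 0.
Proof.
move=> e e0; exists 1 => // h _.
rewrite [X in `|X|](_ : _ = 0); last by rewrite cReD; ring.
by rewrite normr0 mulr_ge0 ?cabs_ge0// ltW.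
Qed.

Lemma rdiff_Im c : rdiff (fun w => Im w) c 0 1.
Proof.
move=> e e0; exists 1 => // h _.
rewrite [X in `|X|](_ : _ = 0); last by rewrite cImD; ring.
by rewrite normr0 mulr_ge0 ?cabs_ge0// ltW.
Qed.

Lemma rdiffD X Y c A B A' B' : rdiff X c A B -> rdiff Y c A' B' ->
  rdiff (fun w => X w + Y w) c (A + A') (B + B').
Proof.
move=> HX HY e e0.
have e20 : 0 < e / 2 by rewrite divr_gt0.
have [r r0 Hr] := HX _ e20; have [s s0 Hs] := HY _ e20.
exists (Num.min r s); first by rewrite lt_min r0.
move=> h; rewrite lt_min => /andP[/Hr H1 /Hs H2].
rewrite [X in `|X|](_ : _ = (X (c + h) - X c - (A * Re h + B * Im h)) +
   (Y (c + h) - Y c - (A' * Re h + B' * Im h))); last by ring.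
rewrite (le_trans (ler_normD _ _))// (le_trans (lerD H1 H2))//.
by rewrite -mulrDl -splitr.
Qed.

Lemma rdiffZ (a : R) X c A B : rdiff X c A B ->
  rdiff (fun w => a * X w) c (a * A) (a * B).
Proof.
move=> HX e e0.
have a0 : 0 < `|a| + 1 by rewrite ltr_wpDl.
have [r r0 Hr] := HX (e / (`|a| + 1)) (divr_gt0 e0 a0).
exists r => // h /Hr H.
rewrite [X in `|X|](_ : _ = a * (X (c + h) - X c - (A * Re h + B * Im h))); last by ring.
rewrite normrM (le_trans (ler_wpM2l _ H))// mulrA ler_wpM2r ?cabs_ge0//.
rewrite mulrCA ler_piMr ?(ltW e0)// ler_pdivrMr// mul1r lerDl//.
Qed.

Lemma rdiffN X c A B : rdiff X c A B -> rdiff (fun w => - X w) c (- A) (- B).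
Proof.
move=> /(rdiffZ (-1)); rewrite !mulN1r; apply: rdiff_ext => w.
by rewrite mulN1r.
Qed.

Lemma rdiffB X Y c A B A' B' : rdiff X c A B -> rdiff Y c A' B' ->
  rdiff (fun w => X w - Y w) c (A - A') (B - B').
Proof. by move=> HX /rdiffN; exact: rdiffD. Qed.

Lemma rdiffM X Y c A B A' B' : rdiff X c A B -> rdiff Y c A' B' ->
  rdiff (fun w => X w * Y w) c (A * Y c + X c * A') (B * Y c + X c * B').
Proof.
move=> HX HY e e0.
(* With this [K] the three error terms below add up to exactly [e * cabs h]. *)
pose K := `|X c| + (`|Y c| + 1) + 1.
have K0 : 0 < K by rewrite /K ltr_wpDl// addr_ge0// addr_ge0.
pose L := `|A| + `|B| + 1.
have L0 : 0 < L by rewrite /L ltr_wpDl// addr_ge0.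
have eK : 0 < e / K by rewrite divr_gt0.
have [r r0 Hr] := HX _ eK; have [s s0 Hs] := HY _ eK.
have [t t0 Ht] := rdiff_cts HY ltr01.
have [u u0 Hu] := rdiff_cts HY (divr_gt0 eK L0).
exists (Num.min (Num.min r s) (Num.min t u)); first by rewrite !lt_min r0 s0 t0 u0.
move=> h; rewrite !lt_min => /andP[/andP[/Hr H1 /Hs H2] /andP[/Ht H3 /Hu H4]].
set eX := (X in `|X|) in H1; set eY := (X in `|X|) in H2.
set dY := _ - _ in H3 H4.
rewrite [X in `|X|](_ : _ = X c * eY + (Y c + dY) * eX +
   (A * Re h + B * Im h) * dY); last by rewrite /eX /eY /dY; ring.
have HL : `|A * Re h + B * Im h| <= L * cabs h.
  rewrite (le_trans (ler_normD _ _))// !normrM /L !mulrDl mul1r.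
  rewrite -[leLHS]addr0 lerD ?cabs_ge0// lerD// ler_wpM2l// ?Re_le_cabs ?Im_le_cabs//.
rewrite (_ : e * cabs h = `|X c| * (e / K * cabs h) +
   (`|Y c| + 1) * (e / K * cabs h) + L * cabs h * (e / K / L)); last first.
  rewrite /K; field; apply/andP; split; rewrite gt_eqF//.
have ? : 0 <= cabs h := cabs_ge0 h.
apply: (le_trans (ler_normD _ _)); apply: lerD.
  apply: (le_trans (ler_normD _ _)); apply: lerD; rewrite normrM.
    by rewrite ler_wpM2l.
  rewrite ler_pM// (le_trans (ler_normD _ _))// lerD2l ltW//.
rewrite normrM ler_pM// ltW//.
Qed.

Lemma rdiff_comp (f : R -> R) (f' : R) X c A B :
  (forall e : R, 0 < e -> exists2 r : R, 0 < r & forall h : R, `|h| < r ->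
     `|f (X c + h) - f (X c) - f' * h| <= e * `|h|) ->
  rdiff X c A B -> rdiff (fun w => f (X w)) c (f' * A) (f' * B).
Proof.
move=> Hf HX e e0.
pose L := `|A| + `|B| + 1.
have L0 : 0 < L by rewrite /L ltr_wpDl// addr_ge0.
have f0 : 0 < `|f'| + 1 by rewrite ltr_wpDl.
have e20 : 0 < e / 2 by rewrite divr_gt0.
have [r r0 Hr] := Hf _ (divr_gt0 e20 L0).
have [s s0 Hs] := HX _ (divr_gt0 e20 f0).
have [t t0 Ht] := rdiff_cts HX r0.
have [u u0 Hu] := rdiff_lip HX; rewrite -/L in Hu.
exists (Num.min s (Num.min t u)); first by rewrite !lt_min s0 t0 u0.
move=> h; rewrite !lt_min => /andP[/Hs H1 /andP[/Ht H2 /Hu H3]].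
set dX := _ - _ in H2 H3; set eX := (X in `|X|) in H1.
have := Hr _ H2; rewrite (_ : X c + dX = X (c + h)); last by rewrite /dX; ring.
move=> H4; rewrite [X in `|X|](_ : _ = (f (X (c + h)) - f (X c) - f' * dX) + f' * eX); last first.
  by rewrite /eX /dX; ring.
rewrite (le_trans (ler_normD _ _))// (splitr e) mulrDl lerD//.
  rewrite (le_trans H4)// -[leLHS]mulrA ler_wpM2l ?(ltW e20)//.
  by rewrite mulrC ler_pdivrMr// mulrC.
rewrite normrM (le_trans (ler_wpM2l _ H1))// mulrA ler_wpM2r ?cabs_ge0//.
rewrite mulrCA ler_piMr ?(ltW e20)// ler_pdivrMr// mul1r lerDl//.
Qed.

(** The Cauchy-Riemann equations; [rdiff_cdiff] is the converse. They let sums and products of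
    complex derivatives be read off from the real rules. *)
Lemma cdiff_rdiff F c d : cdiff F c d ->
  rdiff (fun w => Re (F w)) c (Re d) (- Im d) /\
  rdiff (fun w => Im (F w)) c (Im d) (Re d).
Proof.
move=> HF; split=> e /HF[r r0 Hr]; exists r => // h /Hr; apply: le_trans.
  rewrite (le_trans _ (Re_le_cabs _))// !complexReImE.
  by rewrite le_eqVlt; apply/orP; left; apply/eqP; congr `|_|; ring.
rewrite (le_trans _ (Im_le_cabs _))// !complexReImE.
by rewrite le_eqVlt; apply/orP; left; apply/eqP; congr `|_|; ring.
Qed.

Lemma rdiff_cdiff F c d :
  rdiff (fun w => Re (F w)) c (Re d) (- Im d) ->
  rdiff (fun w => Im (F w)) c (Im d) (Re d) -> cdiff F c d.
Proof.
move=> H1 H2 e e0; have e20 : 0 < e / 2 by rewrite divr_gt0.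
have [r r0 Hr] := H1 _ e20; have [s s0 Hs] := H2 _ e20.
exists (Num.min r s); first by rewrite lt_min r0.
move=> h; rewrite lt_min => /andP[/Hr K1 /Hs K2].
rewrite (le_trans (cabs_le _))// (splitr e) mulrDl.
apply: lerD; [apply: le_trans K1|apply: le_trans K2]; rewrite !complexReImE.
  by rewrite le_eqVlt; apply/orP; left; apply/eqP; congr `|_|; ring.
by rewrite le_eqVlt; apply/orP; left; apply/eqP; congr `|_|; ring.
Qed.

Lemma cdiff_ext F G c d : F =1 G -> cdiff F c d -> cdiff G c d.
Proof.
move=> FG HF e /HF[r r0 Hr]; exists r => // h /Hr.
by rewrite !FG.
Qed.

Lemma cdiff_cst (x : C) c : cdiff (fun=> x) c 0.
Proof. by apply: rdiff_cdiff => /=; rewrite ?oppr0; exact: rdiff_cst. Qed.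

Lemma cdiff_id c : cdiff id c 1.
Proof.
by apply: rdiff_cdiff => /=; rewrite ?oppr0; [exact: rdiff_Re|exact: rdiff_Im].
Qed.

Lemma cdiffD F G c d d' : cdiff F c d -> cdiff G c d' ->
  cdiff (fun w => F w + G w) c (d + d').
Proof.
move=> /cdiff_rdiff[F1 F2] /cdiff_rdiff[G1 G2]; apply: rdiff_cdiff.
  rewrite !complexReImE opprD.
  by apply: rdiff_ext (rdiffD F1 G1) => w; rewrite !complexReImE.
rewrite !complexReImE.
by apply: rdiff_ext (rdiffD F2 G2) => w; rewrite !complexReImE.
Qed.

Lemma cdiffM F G c d d' : cdiff F c d -> cdiff G c d' ->
  cdiff (fun w => F w * G w) c (d * G c + F c * d').
Proof.
move=> /cdiff_rdiff[F1 F2] /cdiff_rdiff[G1 G2]; apply: rdiff_cdiff.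
  have := rdiffB (rdiffM F1 G1) (rdiffM F2 G2).
  rewrite [X in rdiff _ _ X](_ : _ = Re (d * G c + F c * d')); last by rewrite !complexReImE; ring.
  rewrite [X in rdiff _ _ _ X](_ : _ = - Im (d * G c + F c * d')); last by rewrite !complexReImE; ring.
  by apply: rdiff_ext => w; rewrite !complexReImE.
have := rdiffD (rdiffM F1 G2) (rdiffM F2 G1).
rewrite [X in rdiff _ _ X](_ : _ = Im (d * G c + F c * d')); last by rewrite !complexReImE; ring.
rewrite [X in rdiff _ _ _ X](_ : _ = Re (d * G c + F c * d')); last by rewrite !complexReImE; ring.
by apply: rdiff_ext => w; rewrite !complexReImE.
Qed.

Lemma cdiff_lip F c d : cdiff F c d ->
  exists2 r : R, 0 < r & forall h, cabs h < r ->
    cabs (F (c + h) - F c) <= (cabs d + 1) * cabs h.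
Proof.
move=> /(_ 1 ltr01)[r r0 Hr]; exists r => // h /Hr; rewrite mul1r => H.
rewrite -(subrK (d * h) (F (c + h) - F c)).
by rewrite (le_trans (cabsD _ _))// addrC mulrDl mul1r lerD// cabsM.
Qed.

Lemma cdiff_cts F c d : cdiff F c d -> forall e : R, 0 < e ->
  exists2 r : R, 0 < r & forall h, cabs h < r -> cabs (F (c + h) - F c) < e.
Proof.
move=> /cdiff_lip[r r0 Hr] e e0.
set K := _ + 1 in Hr.
have K0 : 0 < K by rewrite /K ltr_wpDl// cabs_ge0.
exists (Num.min r (e / K)); first by rewrite lt_min r0 divr_gt0.
move=> h; rewrite lt_min => /andP[/Hr /le_lt_trans + hK]; apply.
by rewrite mulrC -ltr_pdivlMr.
Qed.

Lemma cdiff_comp F G c d d' : cdiff F (G c) d -> cdiff G c d' ->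
  cdiff (fun w => F (G w)) c (d * d').
Proof.
move=> HF HG e e0.
pose L := cabs d' + 1.
have L0 : 0 < L by rewrite /L ltr_wpDl// cabs_ge0.
have f0 : 0 < cabs d + 1 by rewrite ltr_wpDl// cabs_ge0.
have e20 : 0 < e / 2 by rewrite divr_gt0.
have [r r0 Hr] := HF _ (divr_gt0 e20 L0).
have [s s0 Hs] := HG _ (divr_gt0 e20 f0).
have [t t0 Ht] := cdiff_cts HG r0.
have [u u0 Hu] := cdiff_lip HG; rewrite -/L in Hu.
exists (Num.min s (Num.min t u)); first by rewrite !lt_min s0 t0 u0.
move=> h; rewrite !lt_min => /andP[/Hs H1 /andP[/Ht H2 /Hu H3]].
set dX := _ - _ in H2 H3; set eX := (X in cabs X) in H1.
have := Hr _ H2; rewrite (_ : G c + dX = G (c + h)); last by rewrite /dX; ring.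
move=> H4; rewrite [X in cabs X](_ : _ = (F (G (c + h)) - F (G c) - d * dX) + d * eX); last first.
  by rewrite /eX /dX; ring.
rewrite (le_trans (cabsD _ _))// (splitr e) mulrDl lerD//.
  rewrite (le_trans H4)// -[leLHS]mulrA ler_wpM2l ?(ltW e20)//.
  by rewrite mulrC ler_pdivrMr// mulrC.
rewrite cabsM (le_trans (ler_wpM2l (cabs_ge0 _) H1))// mulrA ler_wpM2r ?cabs_ge0//.
rewrite mulrCA ler_piMr ?(ltW e20)// ler_pdivrMr// mul1r lerDl//.
Qed.

(** Reflection turns the conjugate of a holomorphic function back into a holomorphic one; this makes
    products such as Q times a conjugate of Q accessible to Cauchy's theorem. *)
Lemma cdiff_conj F c d : cdiff F c^* d -> cdiff (fun w => (F w^*)^*) c d^*.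
Proof.
move=> HF e /HF[r r0 Hr]; exists r => // h hr.
have := Hr h^*; rewrite !cabs_conj => /(_ hr).
by rewrite -[in X in X -> _]cabs_conj !conjcB !conjcM conjcK conjcD.
Qed.

Lemma cdiff_uniq F c d d' : cdiff F c d -> cdiff F c d' -> d = d'.
Proof.
move=> H H'; apply/eqP; rewrite -subr_eq0 -cabs_eq0; apply/negPn/negP => n0.
have d0 : 0 < cabs (d - d') by rewrite lt_def n0 cabs_ge0.
have e0 : 0 < cabs (d - d') / 4 by rewrite divr_gt0.
have [r r0 Hr] := H _ e0; have [s s0 Hs] := H' _ e0.
pose t := Num.min r s / 2.
have t0 : 0 < t by rewrite divr_gt0// lt_min r0.
have tm : t < Num.min r s by rewrite ltr_pdivrMr// ltr_pMr ?lt_min ?r0// ltr1n.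
have ct : cabs t%:C = t by rewrite cabs_real gtr0_norm.
move: tm; rewrite lt_min -{1 2}ct => /andP[/Hr H1 /Hs H2].
rewrite ct in H1 H2.
have : cabs (d - d') * t <= cabs (d - d') / 4 * t + cabs (d - d') / 4 * t.
  rewrite -{1}ct -cabsM.
  rewrite (_ : (d - d') * t%:C = (F (c + t%:C) - F c - d' * t%:C) + -
      (F (c + t%:C) - F c - d * t%:C)); last by ring.
  rewrite (le_trans (cabsD _ _))// cabsN lerD//.
rewrite -mulrDl ler_pM2r// => ?; lra.
Qed.

End Differentiability.

(** The field is generic because both cases occur: [R[i]] for the conformal maps, and [R] for
    [expR], [cos], [ln] and for primitives. *)
Lemma is_derive_eps (K : numFieldType) (f : K^o -> K^o) (x f' : K^o) :
  is_derive x 1 f f' ->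
  forall e : K, 0 < e -> exists2 r : K, 0 < r & forall h : K, `|h| < r ->
     `|f (x + h) - f x - f' * h| <= e * `|h|.
Proof.
move=> [Df <-] e e0.
have /cvgrPdist_le/(_ e e0) : (h^-1 *: (f (h *: 1 + x) - f x)) @[h --> 0^'] --> 'D_1 f x.
  exact: Df.
rewrite near_withinE => /nbhs_ballP[r /= r0 Hr]; exists r => // h hr.
have [->|h0] := eqVneq h 0.
  by rewrite addr0 subrr mulr0 subrr !normr0 mulr0.
have := Hr h; rewrite /ball /= sub0r normrN => /(_ hr h0).
rewrite (_ : h *: (1 : K^o) = h); last by rewrite /GRing.scale /= mulr1.
rewrite distrC => H.
rewrite -ler_pdivrMr ?normr_gt0// -normfV -normrM (le_trans _ H)//.
rewrite le_eqVlt; apply/orP; left; apply/eqP; congr `|_|.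
rewrite /GRing.scale /= (addrC x h) mulrC mulrBr mulrCA.
by rewrite mulVf// mulr1.
Qed.

Section ComplexDerivative.
Context {R : realType}.
Implicit Types (f : plane R -> plane R) (z d : plane R).

Lemma is_derive_cdiff f z d : is_derive z 1 f d -> cdiff f z d.
Proof.
move=> /is_derive_eps H e e0.
have := H e%:C; rewrite ltcR => /(_ e0)[r].
(* In the order of [R[i]] a positive radius has imaginary part 0. *)
rewrite ltcE /= => /andP[/eqP ri r0] Hr; exists (Re r) => // h hr.
have {ri}rE : r = (Re r)%:C by apply: complex_eq => //=.
have := Hr h; rewrite !normE {1}rE ltcR => /(_ hr).
by rewrite -rmorphM lecR.
Qed.

Lemma derivable_cdiff f z : derivable f z 1 -> cdiff f z (f^`()%classic z).
Proof. by move=> Df; apply: is_derive_cdiff; rewrite derive1E; exact: DeriveDef. Qed.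

End ComplexDerivative.

(** * Complex exponential and a local logarithm *)

Section ExpLog.
Context {R : realType}.
Local Notation C := R[i].
Implicit Types (z w c : C).

Definition cexp w : C := (expR (Re w) * cos (Im w)) +i* (expR (Re w) * sin (Im w)).

Lemma rdiff_comp_derive (f : R -> R) (f' : R) (X : C -> R) c A B :
  is_derive (X c) 1 f f' -> rdiff X c A B ->
  rdiff (fun w => f (X w)) c (f' * A) (f' * B).
Proof. by move=> /is_derive_eps Hf; exact: rdiff_comp. Qed.

Lemma cdiff_cexp c : cdiff cexp c (cexp c).
Proof.
have He := rdiff_comp_derive (is_derive_expR (Re c)) (rdiff_Re c).
have Hc := rdiff_comp_derive (is_derive_cos (Im c)) (rdiff_Im c).
have Hs := rdiff_comp_derive (is_derive_sin (Im c)) (rdiff_Im c).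
apply: rdiff_cdiff => /=.
  have := rdiffM He Hc; rewrite !mulr0 !mulr1 mul0r addr0 add0r.
  by rewrite mulrN.
by have := rdiffM He Hs; rewrite !mulr0 !mulr1 mul0r addr0 add0r.
Qed.

Lemma cabs_cexp w : cabs (cexp w) = expR (Re w).
Proof.
rewrite /= !exprMn -mulrDr cos2Dsin2 mulr1 sqrtr_sqr ger0_norm//.
Qed.

Lemma cexp_neq0 w : cexp w != 0.
Proof. by rewrite -cabs_gt0 cabs_cexp expR_gt0. Qed.

Lemma cexpD z w : cexp (z + w) = cexp z * cexp w.
Proof.
case: z => a b; case: w => c d; rewrite /cexp /=.
apply: complex_eq => /=; rewrite expRD ?cosD ?sinD; ring.
Qed.

Lemma cexp0 : cexp 0 = 1.
Proof. by rewrite /cexp /= expR0 cos0 sin0 mulr1 mulr0. Qed.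

Lemma cexpN w : cexp (- w) = (cexp w)^-1.
Proof.
apply: (mulfI (cexp_neq0 w)); rewrite -cexpD subrr cexp0 mulfV//.
exact: cexp_neq0.
Qed.

Lemma cexp_period w : cexp (w + (0 +i* (pi *+ 2))) = cexp w.
Proof. by rewrite /cexp cReD cImD /= addr0 cosD2pi sinD2pi. Qed.

Lemma cos_eq1_small (x : R) : `|x| < pi *+ 2 -> cos x = 1 -> x = 0.
Proof.
wlog x0 : x / 0 <= x.
  move=> H; have [x0|x0] := leP 0 x; first exact: H.
  move=> xp cx; apply/eqP; rewrite -oppr_eq0; apply/eqP; apply: H => //.
  - by rewrite oppr_ge0 ltW.
  - by rewrite normrN.
  - by rewrite cosN.
rewrite ger0_norm// => xp cx; apply/eqP; apply: contraT => xn.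
have {}x0 : 0 < x by rewrite lt_def xn.
have : 0 < sin (x / 2).
  apply: sin_gt0_pi; rewrite divr_gt0//= ltr_pdivrMr//.
  by rewrite mulr_natr.
have : cos ((x / 2) *+ 2) = 1 by rewrite -mulr_natr divfK.
rewrite cos_mulr2n => /eqP; rewrite subr_eq -mulr2n eqrMn2r//= => /eqP H s0.
have := cos2Dsin2 (x / 2); rewrite H => /eqP.
by rewrite -subr_eq0 addrAC subrr add0r sqrf_eq0 gt_eqF.
Qed.

(** Source of the disjointness of images of adjacent rectangles of total height at most 2 pi. *)
Lemma cexp_inj z w : `|Im z - Im w| < pi *+ 2 -> cexp z = cexp w -> z = w.
Proof.
move=> hz e.
have eR : Re z = Re w.
  by apply: expR_inj; rewrite -!cabs_cexp e.
have : cexp (z - w) = 1 by rewrite cexpD cexpN e mulfV// cexp_neq0.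
rewrite /cexp cReD cReN eR subrr expR0 !mul1r cImD cImN => -[hc hs].
apply: complex_eq => //; apply/eqP; rewrite -subr_eq0; apply/eqP.
exact: cos_eq1_small.
Qed.

(* The principal logarithm, on the half-plane 0 < Re z only. *)
Definition clog z : C := (ln (Re z ^+ 2 + Im z ^+ 2) / 2) +i* (atan (Im z / Re z)).

Lemma clogK z : 0 < Re z -> cexp (clog z) = z.
Proof.
case: z => x y /= x0; rewrite /cexp /clog /=.
have q0 : 0 < x ^+ 2 + y ^+ 2 by rewrite ltr_wpDr ?sqr_ge0// exprn_gt0.
have E : expR (ln (x ^+ 2 + y ^+ 2) / 2) = Num.sqrt (x ^+ 2 + y ^+ 2).
  rewrite -[LHS]ger0_norm ?expR_ge0// -sqrtr_sqr -expRM_natr divfK//.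
  by rewrite lnK.
have S : Num.sqrt (x ^+ 2 + y ^+ 2) = x * Num.sqrt (1 + (y / x) ^+ 2).
  rewrite [in LHS](_ : _ + _ = x ^+ 2 * (1 + (y / x) ^+ 2)).
    by rewrite sqrtrM ?sqr_ge0// sqrtr_sqr ger0_norm// ltW.
  by field; exact: lt0r_neq0.
have T0 : 0 < Num.sqrt (1 + (y / x) ^+ 2).
  by rewrite sqrtr_gt0 ltr_wpDr ?sqr_ge0.
have c0 : cos (atan (y / x)) = (Num.sqrt (1 + (y / x) ^+ 2))^-1 by exact: cos_atan.
have s0 : sin (atan (y / x)) = y / x * cos (atan (y / x)).
  have T := atanK (y / x); set t := atan _ in T c0 *.
  by rewrite -T /tan divfK// c0 invr_neq0// gt_eqF.
rewrite E S; apply: complex_eq => /=.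
  by rewrite c0 mulfK// gt_eqF.
rewrite s0 c0; field; rewrite !gt_eqF//.
Qed.

(** The point 1 suffices: the local inverse of the parametrisation evaluates [clog] at 1 when taken
    at its base point. *)
Lemma cdiff_clog1 : cdiff clog 1 1.
Proof.
have H1 : rdiff (fun z : C => Re z ^+ 2 + Im z ^+ 2) 1 2 0.
  have := rdiffD (rdiffM (rdiff_Re 1) (rdiff_Re 1)) (rdiffM (rdiff_Im 1) (rdiff_Im 1)).
  rewrite /= => H; rewrite (_ : 2 = 1 * 1 + 1 * 1 + (0 * 0 + 0 * 0)); last by ring.
  by rewrite [X in rdiff _ _ _ X](_ : 0 = 0 * 1 + 1 * 0 + (1 * 0 + 0 * 1))//; ring.
have H2 : rdiff (fun z : C => (Re z)^-1) 1 (-1) 0.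
  have := @rdiff_comp_derive (fun x => x^-1) (- 1) (fun w => Re w) 1 1 0.
  rewrite mulr0 mulr1; apply; last exact: rdiff_Re.
  have := @realfun.is_deriveV R id 1 1 1 (oner_neq0 _) (is_derive_id _ _).
  by rewrite expr1n invr1 /GRing.scale /= mulr1.
have H3 := rdiffM (rdiff_Im 1) H2.
rewrite /= in H3; rewrite !(mul0r, mulr0, add0r, addr0, invr1, mulr1) in H3.
have H4 : rdiff (fun z : C => atan (Im z / Re z)) 1 0 1.
  have := @rdiff_comp_derive (@atan R) 1 _ 1 0 1 _ H3.
  rewrite !(mulr0, mulr1); apply.
  rewrite /= mul0r; have := is_derive1_atan (0 : R).
  by rewrite expr0n /= addr0 invr1.
have H5 : rdiff (fun z : C => ln (Re z ^+ 2 + Im z ^+ 2)) 1 2 0.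
  have := @rdiff_comp_derive (@ln R) 1 _ 1 2 0 _ H1.
  rewrite !(mulr0, mul1r); apply.
  rewrite /= expr0n /= addr0 expr1n; have := is_derive1_ln (@ltr01 R).
  by rewrite invr1.
apply: rdiff_cdiff => /=; rewrite ?oppr0//.
have := rdiffZ 2^-1 H5; rewrite mulr0 mulVf ?pnatr_eq0//.
by apply: rdiff_ext => w; rewrite mulrC.
Qed.
End ExpLog.

(** * Bisection of rectangles *)

Section Bisection.
Context {R : realType}.

Lemma nested_point (u t : R ^nat) :
  (forall n, u n <= u n.+1) -> (forall n, u n.+1 + t n.+1 <= u n + t n) ->
  (forall n, 0 <= t n) -> exists c, forall n, u n <= c <= u n + t n.
Proof.
move=> u1 u2 t0.
have um n m : (n <= m)%N -> u n <= u m.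
  by move=> nm; exact: (homo_leq (@lexx _ _) (@le_trans _ _) u1).
have vm n m : (n <= m)%N -> u m + t m <= u n + t n.
  elim: m => [|m IH]; first by rewrite leqn0 => /eqP ->.
  by rewrite leq_eqVlt => /predU1P[->//|/IH]; exact: le_trans.
have uv n m : u n <= u m + t m.
  have [nm|/ltnW mn] := leqP n m.
    by rewrite (le_trans (um _ _ nm))// lerDl.
  by rewrite (le_trans _ (vm _ _ mn))// lerDl.
exists (sup (range u)) => n; apply/andP; split.
  apply: ub_le_sup; last by exists n.
  by exists (u 0%N + t 0%N) => _ [m _ <-].
by apply: ge_sup; [exists (u 0%N), 0%N|move=> _ [m _ <-]].
Qed.

Lemma small_half (r : R) : 0 < r -> exists n : nat, (2 ^- n : R) < r.
Proof.
move=> r0.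
have /cvgrPdist_lt/(_ r r0) : ((2^-1 : R) ^+ n) @[n --> \oo] --> (0 : R).
  by apply: cvg_expr; rewrite ger0_norm ?invr_ge0// invf_lt1// ltr1n.
move=> [n _ Hn]; exists n; have := Hn n (leqnn n).
by rewrite sub0r normrN exprVn ger0_norm// invr_ge0 exprn_ge0.
Qed.

(** The rectangle with corner (x, y) and sides t l, t k. It is similar to the original one, so
    [t ^+ 2] measures its area up to a constant. *)
Definition subrect (x0 y0 l k x y t : R) :=
  [/\ 0 < t, x0 <= x, x + t * l <= x0 + l, y0 <= y & y + t * k <= y0 + k].

(** If [S x0 y0 1] were -2e with e > 0, then any rectangle with [S] below -e t^2 would have a
    quarter of scale t/2 with the same defect, since the four quarters share e t^2 equally. The
    nested rectangles shrink to a point at which the local bound fails. *)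
Lemma bisection (S : R -> R -> R -> R) (x0 y0 l k : R) :
  0 < l -> 0 < k ->
  (forall x y t, subrect x0 y0 l k x y t ->
     S x y (t / 2) + S (x + t / 2 * l) y (t / 2) + S x (y + t / 2 * k) (t / 2)
       + S (x + t / 2 * l) (y + t / 2 * k) (t / 2) <= S x y t) ->
  (forall cx cy, x0 <= cx <= x0 + l -> y0 <= cy <= y0 + k ->
     forall e, 0 < e -> exists2 r, 0 < r & forall x y t,
       subrect x0 y0 l k x y t -> t < r -> x <= cx <= x + t * l ->
       y <= cy <= y + t * k -> - (e * t ^+ 2) <= S x y t) ->
  0 <= S x0 y0 1.
Proof.
move=> l0 k0 Hsup Hloc; rewrite leNgt; apply/negP => S0.
pose e := - S x0 y0 1 / 2.
have e0 : 0 < e by rewrite divr_gt0// oppr_gt0.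
pose T n : R := 2 ^- n.
have T0 n : 0 < T n by rewrite invr_gt0 exprn_gt0.
have TS n : T n.+1 = T n / 2 by rewrite /T exprS invfM mulrC.
pose bad n (p : R * R) := subrect x0 y0 l k p.1 p.2 (T n) /\
  S p.1 p.2 (T n) < - (e * T n ^+ 2).
pose rel n (p q : R * R) := [/\ p.1 <= q.1, q.1 + T n.+1 * l <= p.1 + T n * l,
  p.2 <= q.2 & q.2 + T n.+1 * k <= p.2 + T n * k].
have step n : forall p, exists q, bad n p -> bad n.+1 q /\ rel n p q.
  move=> [x y]; have [|nb] := pselect (bad n (x, y)); last by exists (x, y).
  move=> [/= sub B].
  have Tl : 0 < T n.+1 * l by rewrite mulr_gt0.
  have Tk : 0 < T n.+1 * k by rewrite mulr_gt0.
  have El : T n * l = T n.+1 * l + T n.+1 * l.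
    by rewrite -mulrDl TS -splitr.
  have Ek : T n * k = T n.+1 * k + T n.+1 * k.
    by rewrite -mulrDl TS -splitr.
  have := Hsup _ _ _ sub; rewrite -TS => HS.
  case: sub => _ s1 s2 s3 s4.
  have cand x' y' : x' = x \/ x' = x + T n.+1 * l -> y' = y \/ y' = y + T n.+1 * k ->
      S x' y' (T n.+1) < - (e * T n.+1 ^+ 2) ->
      exists q, bad n (x, y) -> bad n.+1 q /\ rel n (x, y) q.
    clear - Tl Tk El Ek s1 s2 s3 s4 T0; move: (T0 n.+1) => T0n Hx Hy HB.
    exists (x', y') => _; rewrite /bad /rel /subrect /=.
    by case: Hx HB => ->; case: Hy => -> HB; (split; [split; [split|]|split]) => //; lra.
  have [H|H1] := ltP (S x y (T n.+1)) (- (e * T n.+1 ^+ 2)).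
    by apply: (cand x y) => //; left.
  have [H|H2] := ltP (S (x + T n.+1 * l) y (T n.+1)) (- (e * T n.+1 ^+ 2)).
    by apply: (cand (x + T n.+1 * l) y) => //; [right|left].
  have [H|H3] := ltP (S x (y + T n.+1 * k) (T n.+1)) (- (e * T n.+1 ^+ 2)).
    by apply: (cand x (y + T n.+1 * k)) => //; [left|right].
  have [H|H4] := ltP (S (x + T n.+1 * l) (y + T n.+1 * k) (T n.+1)) (- (e * T n.+1 ^+ 2)).
    by apply: (cand (x + T n.+1 * l) (y + T n.+1 * k)) => //; right.
  exfalso; move: B; apply/negP; rewrite -leNgt (le_trans _ HS)//.
  have -> : e * T n ^+ 2 = e * T n.+1 ^+ 2 * 4 by rewrite TS; field.
  lra.
have /choice[f Hf] : forall a : nat * (R * R), exists q, bad a.1 a.2 ->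
    bad a.1.+1 q /\ rel a.1 a.2 q by move=> [n p]; exact: step.
pose u := fix u n := if n is m.+1 then f (m, u m) else (x0, y0).
have ub n : bad n (u n).
  elim: n => [|n IH]; last by have [] := Hf (n, u n) IH.
  split => /=; rewrite /T expr0 invr1; first by split; rewrite ?mul1r.
  by rewrite expr1n mulr1 /e; lra.
have ur n : rel n (u n) (u n.+1) by have [] := Hf (n, u n) (ub n).
have [cx Hcx] : exists c, forall n, (u n).1 <= c <= (u n).1 + T n * l.
  apply: (@nested_point (fun n => (u n).1) (fun n => T n * l)) => n.
  - by case: (ur n).
  - by case: (ur n).
  - by rewrite mulr_ge0// ltW.
have [cy Hcy] : exists c, forall n, (u n).2 <= c <= (u n).2 + T n * k.
  apply: (@nested_point (fun n => (u n).2) (fun n => T n * k)) => n.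
  - by case: (ur n).
  - by case: (ur n).
  - by rewrite mulr_ge0// ltW.
have T01 : T 0%N = 1 by rewrite /T expr0 invr1.
have Kx : x0 <= cx <= x0 + l.
  by have := Hcx 0%N; rewrite /= T01 mul1r.
have Ky : y0 <= cy <= y0 + k.
  by have := Hcy 0%N; rewrite /= T01 mul1r.
have [r r0 Hr] := Hloc cx cy Kx Ky e e0.
have [n nr] := small_half r0.
case: (ub n) => sub; apply/negP; rewrite -leNgt.
exact: (Hr _ _ _ sub nr (Hcx n) (Hcy n)).
Qed.

End Bisection.

(** * Boundary integrals *)

Section SegmentIntegral.
Context {R : realType}.
Local Notation mu := (@lebesgue_measure R).
Implicit Types (f g : R -> R) (a b c : R).

Definition segint f a b := \int[mu]_(x in `[a, b]) f x.
Definition segcont f a b := {within `[a, b], continuous f}.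

Lemma segcont_eps f a b :
  (forall x, a <= x <= b -> forall e, 0 < e -> exists2 r, 0 < r &
     forall y, `|y - x| < r -> `|f y - f x| < e) -> segcont f a b.
Proof.
move=> H; apply: continuous_in_subspaceT => x.
rewrite inE /= in_itv /= => /H{}H.
apply/cvgrPdist_lt => e /H[r r0 Hr]; apply/nbhs_ballP; exists r => // y.
by rewrite /ball /= distrC => /Hr; rewrite distrC.
Qed.

Lemma segint_integrable f a b : segcont f a b -> mu.-integrable `[a, b] (EFin \o f).
Proof. by move=> cf; apply: continuous_compact_integrable => //; exact: segment_compact. Qed.

Lemma segcontD f g a b : segcont f a b -> segcont g a b ->
  segcont (fun x => f x + g x) a b.
Proof. by move=> cf cg x; apply: cvgD; [exact: cf|exact: cg]. Qed.

Lemma segcontM f g a b : segcont f a b -> segcont g a b ->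
  segcont (fun x => f x * g x) a b.
Proof. by move=> cf cg x; apply: cvgM; [exact: cf|exact: cg]. Qed.

Lemma segcont_cst (c : R) a b : segcont (fun=> c) a b.
Proof. by move=> x; exact: cvg_cst. Qed.

Lemma segcontN f a b : segcont f a b -> segcont (fun x => - f x) a b.
Proof. by move=> cf x; apply: cvgN; exact: cf. Qed.

Lemma segcontS f a b a' b' : a <= a' -> b' <= b -> segcont f a b -> segcont f a' b'.
Proof.
move=> aa bb; apply: continuous_subspaceW => x /=; rewrite !in_itv /=.
by move=> /andP[/(le_trans aa) -> /le_trans ->].
Qed.

Lemma segintD f g a b : segcont f a b -> segcont g a b ->
  segint (fun x => f x + g x) a b = segint f a b + segint g a b.
Proof. by move=> /segint_integrable cf /segint_integrable cg; exact: RintegralD. Qed.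

Lemma segintZ (c : R) f a b : segcont f a b ->
  segint (fun x => c * f x) a b = c * segint f a b.
Proof. by move=> /segint_integrable cf; exact: RintegralZl. Qed.

Lemma segintN f a b : segcont f a b ->
  segint (fun x => - f x) a b = - segint f a b.
Proof.
move=> cf; rewrite -mulN1r -segintZ//; apply: eq_Rintegral => x _.
by rewrite mulN1r.
Qed.

Lemma segintB f g a b : segcont f a b -> segcont g a b ->
  segint (fun x => f x - g x) a b = segint f a b - segint g a b.
Proof.
by move=> cf cg; rewrite -segintN// -segintD//; exact: segcontN.
Qed.

Lemma eq_segint f g a b : (forall x, a <= x <= b -> f x = g x) ->
  segint f a b = segint g a b.
Proof.
by move=> fg; apply: eq_Rintegral => x; rewrite inE /= in_itv /=; exact: fg.
Qed.

Lemma segint_cst (c : R) a b : a <= b -> segint (fun=> c) a b = c * (b - a).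
Proof.
move=> ab; rewrite /segint Rintegral_cst//= lebesgue_measure_itv /= lte_fin.
by move: ab; rewrite le_eqVlt => /predU1P[->|->//]; rewrite ltxx subrr.
Qed.

Lemma le_segint f g a b : segcont f a b -> segcont g a b ->
  (forall x, a <= x <= b -> f x <= g x) -> segint f a b <= segint g a b.
Proof.
move=> /segint_integrable cf /segint_integrable cg fg.
by apply: le_Rintegral => // x /=; rewrite in_itv /=; exact: fg.
Qed.

Lemma segint_split f a b c : a <= b -> b <= c -> segcont f a c ->
  segint f a c = segint f a b + segint f b c.
Proof.
move=> ab bc /segint_integrable cf.
have ab' : (BLeft a <= BRight b :> itv_bound R)%O by rewrite bnd_simp.
have bc' : (BRight b <= BRight c :> itv_bound R)%O by rewrite bnd_simp.
have := Rintegral_itvB cf ab' bc'; rewrite Rintegral_itv_obnd_cbnd; last first.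
  by apply: integrableS cf => //; apply: subset_itvr; rewrite bnd_simp.
by rewrite /segint => <-; rewrite addrC subrK.
Qed.

Lemma segint_bound f a b (m : R) : a <= b -> segcont f a b ->
  (forall x, a <= x <= b -> `|f x| <= m) -> `|segint f a b| <= m * (b - a).
Proof.
move=> ab cf H; rewrite ler_norml; apply/andP; split.
  rewrite -mulNr -segint_cst//; apply: le_segint => //; first exact: segcont_cst.
  by move=> x /H; rewrite ler_norml => /andP[].
rewrite -segint_cst//; apply: le_segint => //; first exact: segcont_cst.
by move=> x /H; rewrite ler_norml => /andP[].
Qed.

Lemma segint_ge0 f a b : (forall x, a <= x <= b -> 0 <= f x) -> 0 <= segint f a b.
Proof. by move=> H; apply: Rintegral_ge0 => x /=; rewrite in_itv /=; exact: H. Qed.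

End SegmentIntegral.

Section Green.
Context {R : realType}.
Local Notation C := R[i].
Implicit Types (X Y : C -> R) (c : C).

Lemma rdiff_segcontV X (x a b : R) :
  (forall y, a <= y <= b -> exists A B, rdiff X (x +i* y) A B) ->
  segcont (fun y => X (x +i* y)) a b.
Proof.
move=> H; apply: segcont_eps => y /H[A [B /rdiff_cts HX]] e /HX[r r0 Hr].
exists r => // z hz.
have := Hr (0 +i* (z - y)); rewrite (_ : cabs _ = `|z - y|); last first.
  by rewrite /= expr0n /= add0r sqrtr_sqr.
move=> /(_ hz); rewrite (_ : _ +i* _ + _ = x +i* z)//.
by apply: complex_eq; rewrite ?complexReImE /=; ring.
Qed.

Lemma rdiff_segcontH X (y a b : R) :
  (forall x, a <= x <= b -> exists A B, rdiff X (x +i* y) A B) ->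
  segcont (fun x => X (x +i* y)) a b.
Proof.
move=> H; apply: segcont_eps => x /H[A [B /rdiff_cts HX]] e /HX[r r0 Hr].
exists r => // z hz.
have := Hr ((z - x)%:C); rewrite cabs_real => /(_ hz).
rewrite (_ : _ +i* _ + _ = z +i* y)//.
by apply: complex_eq; rewrite ?complexReImE /=; ring.
Qed.

(** Outward flux of the field ([X], [Y]). For [X] = Re F and [Y] = - Im F it is the imaginary part
    of the contour integral of F. *)
Definition bdry X Y (x x' y y' : R) :=
  segint (fun v => X (x' +i* v) - X (x +i* v)) y y' +
  segint (fun u => Y (u +i* y') - Y (u +i* y)) x x'.

Definition inrect (x x' y y' : R) c := (x <= Re c <= x') && (y <= Im c <= y').

Definition rdiff_on (P : C -> bool) X (A B : C -> R) :=
  forall c, P c -> rdiff X c (A c) (B c).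

Section Bdry.
Variables (X Y XA XB YA YB : C -> R).

Lemma bdry_segcont (x x' y y' u v : R) :
  rdiff_on (inrect x x' y y') X XA XB ->
  (x <= u <= x' -> segcont (fun v => X (u +i* v)) y y') /\
  (y <= v <= y' -> segcont (fun u => X (u +i* v)) x x').
Proof.
move=> H; split => hu.
  by apply: rdiff_segcontV => w hw; do 2 eexists; apply: H; rewrite /inrect /= hu.
by apply: rdiff_segcontH => w hw; do 2 eexists; apply: H; rewrite /inrect /= hu hw.
Qed.

Lemma segcont_diffV (x x' y y' u u' a b : R) :
  rdiff_on (inrect x x' y y') X XA XB -> x <= u <= x' -> x <= u' <= x' ->
  y <= a -> b <= y' -> segcont (fun v => X (u' +i* v) - X (u +i* v)) a b.
Proof.
move=> H hu hu' ha hb; apply: (segcontS ha hb); apply: segcontD.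
  exact: (bdry_segcont u' 0 H).1.
by apply: segcontN; exact: (bdry_segcont u 0 H).1.
Qed.

Lemma segcont_diffH (x x' y y' v v' a b : R) :
  rdiff_on (inrect x x' y y') Y YA YB -> y <= v <= y' -> y <= v' <= y' ->
  x <= a -> b <= x' -> segcont (fun u => Y (u +i* v') - Y (u +i* v)) a b.
Proof.
move=> H hu hu' ha hb; apply: (segcontS ha hb); apply: segcontD.
  apply: rdiff_segcontH => w hw; do 2 eexists; apply: H.
  by rewrite /inrect /= hw.
apply: segcontN; apply: rdiff_segcontH => w hw; do 2 eexists; apply: H.
by rewrite /inrect /= hw.
Qed.

Lemma bdry_splitH (x x' x'' y y' : R) : x <= x' -> x' <= x'' -> y <= y' ->
  rdiff_on (inrect x x'' y y') X XA XB -> rdiff_on (inrect x x'' y y') Y YA YB ->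
  bdry X Y x x'' y y' = bdry X Y x x' y y' + bdry X Y x' x'' y y'.
Proof.
move=> h1 h2 h3 HX HY.
have h12 := le_trans h1 h2.
rewrite /bdry (@segint_split _ _ x x' x'')//; last first.
  by apply: (segcont_diffH HY); rewrite ?lexx ?h3.
rewrite addrACA -segintD; last 2 first.
- by apply: (segcont_diffV HX); rewrite ?lexx ?h12 ?h1.
- by apply: (segcont_diffV HX); rewrite ?lexx ?h12 ?h1.
by congr (_ + _); apply: eq_segint => v _; ring.
Qed.

Lemma bdry_splitV (x x' y y' y'' : R) : x <= x' -> y <= y' -> y' <= y'' ->
  rdiff_on (inrect x x' y y'') X XA XB -> rdiff_on (inrect x x' y y'') Y YA YB ->
  bdry X Y x x' y y'' = bdry X Y x x' y y' + bdry X Y x x' y' y''.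
Proof.
move=> h1 h2 h3 HX HY.
have h23 := le_trans h2 h3.
rewrite /bdry (@segint_split _ _ y y' y'')//; last first.
  by apply: (segcont_diffV HX); rewrite ?lexx ?h1.
rewrite addrACA -[in RHS]segintD; last 2 first.
- by apply: (segcont_diffH HY); rewrite ?lexx ?h23 ?h2.
- by apply: (segcont_diffH HY); rewrite ?lexx ?h23 ?h2.
by congr (_ + _); apply: eq_segint => v _; ring.
Qed.

Lemma segint_affine_err (f : R -> R) (K a b m : R) : a <= b -> segcont f a b ->
  (forall v, a <= v <= b -> `|f v - K| <= m) ->
  `|segint f a b - K * (b - a)| <= m * (b - a).
Proof.
move=> ab cf H; rewrite -segint_cst// -segintB//; last exact: segcont_cst.
apply: segint_bound => //.
by apply: segcontD => //; apply: segcontN; exact: segcont_cst.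
Qed.

(** Opposite sides are compared at equal height or abscissa, so the tangential part of the affine
    approximation cancels and only the divergence remains. Each pair of sides has error [e * D]
    times its length, and these add up to [e * D ^+ 2]. *)
Lemma bdry_local c (x0 x0' y0 y0' : R) :
  rdiff_on (inrect x0 x0' y0 y0') X XA XB ->
  rdiff_on (inrect x0 x0' y0 y0') Y YA YB ->
  inrect x0 x0' y0 y0' c ->
  forall e, 0 < e -> exists2 r, 0 < r & forall x x' y y',
    x0 <= x -> x' <= x0' -> y0 <= y -> y' <= y0' ->
    inrect x x' y y' c -> (x' - x) + (y' - y) < r ->
    `|bdry X Y x x' y y' - (XA c + YB c) * ((x' - x) * (y' - y))| <=
    e * ((x' - x) + (y' - y)) ^+ 2.
Proof.
move=> HX HY hc e e0; have e20 : 0 < e / 2 by rewrite divr_gt0.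
have [r r0 Hr] := HX _ hc _ e20; have [s s0 Hs] := HY _ hc _ e20.
exists (Num.min r s); first by rewrite lt_min r0.
move=> x x' y y' hx hx' hy hy' /andP[/andP[c1 c2] /andP[c3 c4]].
set D := _ + _; rewrite lt_min => /andP[Dr Ds].
have hxx : x <= x' := le_trans c1 c2.
have hyy : y <= y' := le_trans c3 c4.
have D0 : 0 <= D by rewrite /D addr_ge0 ?subr_ge0.
have near p q : x <= p <= x' -> y <= q <= y' -> cabs (p +i* q - c) <= D.
  move=> /andP[p1 p2] /andP[q1 q2]; rewrite (le_trans (cabs_le _))// !complexReImE /=.
  by apply: lerD; rewrite ler_norml; lra.
have EX p q : x <= p <= x' -> y <= q <= y' ->
    `|X (p +i* q) - X c - (XA c * (p - Re c) + XB c * (q - Im c))| <= e / 2 * D.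
  move=> hp hq; have := near p q hp hq => hn.
  have := Hr (p +i* q - c) (le_lt_trans hn Dr).
  rewrite (_ : c + (p +i* q - c) = p +i* q); last by ring.
  rewrite !complexReImE /= => /le_trans; apply.
  by rewrite ler_wpM2l// ltW.
have EY p q : x <= p <= x' -> y <= q <= y' ->
    `|Y (p +i* q) - Y c - (YA c * (p - Re c) + YB c * (q - Im c))| <= e / 2 * D.
  move=> hp hq; have := near p q hp hq => hn.
  have := Hs (p +i* q - c) (le_lt_trans hn Ds).
  rewrite (_ : c + (p +i* q - c) = p +i* q); last by ring.
  rewrite !complexReImE /= => /le_trans; apply.
  by rewrite ler_wpM2l// ltW.
have I1 : `|segint (fun v => X (x' +i* v) - X (x +i* v)) y y' -
    XA c * (x' - x) * (y' - y)| <= e * D * (y' - y).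
  apply: segint_affine_err => //.
    by apply: (segcont_diffV HX); rewrite // ?hx ?hx' ?(le_trans hx) ?(le_trans _ hx').
  move=> v hv.
  have H1 := EX x v; rewrite lexx hxx in H1; have {}H1 := H1 isT hv.
  have H2 := EX x' v; rewrite lexx hxx in H2; have {}H2 := H2 isT hv.
  rewrite (_ : _ - XA c * (x' - x) =
    (X (x' +i* v) - X c - (XA c * (x' - Re c) + XB c * (v - Im c))) -
    (X (x +i* v) - X c - (XA c * (x - Re c) + XB c * (v - Im c)))); last by ring.
  by rewrite (le_trans (ler_normB _ _))// (le_trans (lerD H2 H1))// -mulrDl -splitr.
have I2 : `|segint (fun u => Y (u +i* y') - Y (u +i* y)) x x' -
    YB c * (y' - y) * (x' - x)| <= e * D * (x' - x).
  apply: segint_affine_err => //.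
    by apply: (segcont_diffH HY); rewrite // ?hy ?hy' ?(le_trans hy) ?(le_trans _ hy').
  move=> v hv.
  have H1 := EY v y hv; rewrite lexx hyy in H1; have {}H1 := H1 isT.
  have H2 := EY v y' hv; rewrite lexx hyy in H2; have {}H2 := H2 isT.
  rewrite (_ : _ - YB c * (y' - y) =
    (Y (v +i* y') - Y c - (YA c * (v - Re c) + YB c * (y' - Im c))) -
    (Y (v +i* y) - Y c - (YA c * (v - Re c) + YB c * (y - Im c)))); last by ring.
  by rewrite (le_trans (ler_normB _ _))// (le_trans (lerD H2 H1))// -mulrDl -splitr.
rewrite (_ : _ - (XA c + YB c) * _ =
  (segint (fun v => X (x' +i* v) - X (x +i* v)) y y' - XA c * (x' - x) * (y' - y)) +
  (segint (fun u => Y (u +i* y') - Y (u +i* y)) x x' - YB c * (y' - y) * (x' - x)));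
  last by rewrite /bdry; ring.
rewrite (le_trans (ler_normD _ _))// (le_trans (lerD I1 I2))//.
by rewrite -mulrDr addrC -/D -mulrA expr2.
Qed.

(** [Phi] stands in for the double integral of the divergence: [bisection] is applied to [Phi] minus
    the flux. Taking [Phi] = 0 with a divergence-free field gives Cauchy's theorem; taking an inner
    area gives lower bounds for areas. *)
Lemma green_ineq (Phi : R -> R -> R -> R) (x0 y0 l k : R) : 0 < l -> 0 < k ->
  rdiff_on (inrect x0 (x0 + l) y0 (y0 + k)) X XA XB ->
  rdiff_on (inrect x0 (x0 + l) y0 (y0 + k)) Y YA YB ->
  (forall x y t, subrect x0 y0 l k x y t ->
     Phi x y (t / 2) + Phi (x + t / 2 * l) y (t / 2) + Phi x (y + t / 2 * k) (t / 2)
       + Phi (x + t / 2 * l) (y + t / 2 * k) (t / 2) <= Phi x y t) ->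
  (forall c, inrect x0 (x0 + l) y0 (y0 + k) c ->
     forall e, 0 < e -> exists2 r, 0 < r & forall x y t,
       subrect x0 y0 l k x y t -> t < r -> inrect x (x + t * l) y (y + t * k) c ->
       (XA c + YB c) * (t * l * (t * k)) - e * t ^+ 2 <= Phi x y t) ->
  bdry X Y x0 (x0 + l) y0 (y0 + k) <= Phi x0 y0 1.
Proof.
move=> l0 k0 HX HY Hsup Hloc.
pose S x y t := Phi x y t - bdry X Y x (x + t * l) y (y + t * k).
suff : 0 <= S x0 y0 1 by rewrite /S !mul1r subr_ge0.
apply: (@bisection _ S x0 y0 l k) => // [x y t sub|cx cy hx hy e e0].
  have := Hsup _ _ _ sub; case: sub => t0 s1 s2 s3 s4 H; rewrite /S.
  have E1 : x + t * l = x + t / 2 * l + t / 2 * l by field.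
  have E2 : y + t * k = y + t / 2 * k + t / 2 * k by field.
  have tl : 0 < t / 2 * l by rewrite mulr_gt0// divr_gt0.
  have tk : 0 < t / 2 * k by rewrite mulr_gt0// divr_gt0.
  rewrite {}E1 {}E2 in s2 s4 *.
  set u := t / 2 * l in tl s2 H *; set v := t / 2 * k in tk s4 H *.
  have HX' a a' b b' : x0 <= a -> a' <= x0 + l -> y0 <= b -> b' <= y0 + k ->
     rdiff_on (inrect a a' b b') X XA XB.
    move=> h1 h2 h3 h4 c /andP[/andP[c1 c2] /andP[c3 c4]]; apply: HX.
    by rewrite /inrect (le_trans h1)// (le_trans c2)// (le_trans h3)// (le_trans c4).
  have HY' a a' b b' : x0 <= a -> a' <= x0 + l -> y0 <= b -> b' <= y0 + k ->
     rdiff_on (inrect a a' b b') Y YA YB.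
    move=> h1 h2 h3 h4 c /andP[/andP[c1 c2] /andP[c3 c4]]; apply: HY.
    by rewrite /inrect (le_trans h1)// (le_trans c2)// (le_trans h3)// (le_trans c4).
  rewrite [bdry X Y x (x + u + u) y (y + v + v)](@bdry_splitH _ (x + u)); last 5 first.
  - by lra.
  - by lra.
  - by lra.
  - by apply: HX'; lra.
  - by apply: HY'; lra.
  rewrite [bdry X Y x (x + u) y (y + v + v)](@bdry_splitV _ _ _ (y + v)); last 5 first.
  - by lra.
  - by lra.
  - by lra.
  - by apply: HX'; lra.
  - by apply: HY'; lra.
  rewrite [bdry X Y (x + u) _ y (y + v + v)](@bdry_splitV _ _ _ (y + v)); last 5 first.
  - by lra.
  - by lra.
  - by lra.
  - by apply: HX'; lra.
  - by apply: HY'; lra.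
  move: H; lra.
have hc : inrect x0 (x0 + l) y0 (y0 + k) (cx +i* cy) by rewrite /inrect /= hx hy.
have lk : 0 < l + k by rewrite addr_gt0.
have e20 : 0 < e / 2 by rewrite divr_gt0.
have [r r0 Hr] := Hloc _ hc _ e20.
(* The half-perimeter of the small rectangle is t (l + k); dividing by the square turns the flux
   error into [e / 2 * t ^+ 2]. *)
have e30 : 0 < e / 2 / (l + k) ^+ 2 by rewrite divr_gt0// exprn_gt0.
have [s s0 Hs] := bdry_local HX HY hc e30.
exists (Num.min r (s / (l + k))); first by rewrite lt_min r0 divr_gt0.
move=> x y t sub; rewrite lt_min => /andP[tr ts] hcx hcy.
have hc' : inrect x (x + t * l) y (y + t * k) (cx +i* cy) by rewrite /inrect /= hcx hcy.
have H1 := Hr _ _ _ sub tr hc'.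
case: sub => t0 s1 s2 s3 s4.
have := Hs _ _ _ _ s1 s2 s3 s4 hc'.
rewrite !(addrAC _ _ (- _)) !subrr !add0r -mulrDr -ltr_pdivlMr// => /(_ ts).
rewrite (_ : e / 2 / _ * _ = e / 2 * t ^+ 2); last by field; rewrite gt_eqF.
rewrite ler_norml => /andP[_ H2].
rewrite /S /bdry; lra.
Qed.

End Bdry.
End Green.

(** * Circle means in logarithmic coordinates *)

Section CircleMeans.
Context {R : realType}.
Local Notation C := R[i].
Local Notation tau := (pi *+ 2 : R).
Implicit Types (X : C -> R) (F Q dF dQ : C -> C) (c w : C) (u v x y d : R).

(** The circle has radius e^u. There is no division by 2 pi, hence the factors pi in the later
    bounds. *)
Definition circ X u := segint (fun v => X (u +i* v)) 0 tau.

Definition tau_periodic F := forall w, F (w + (0 +i* tau)) = F w.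

Lemma tau_gt0 : 0 < tau.
Proof. by rewrite mulrn_wgt0// pi_gt0. Qed.

Definition rdiffable X c := exists A B, rdiff X c A B.

Lemma rdiff_circ X u : (forall v, rdiffable X (u +i* v)) ->
  segcont (fun v => X (u +i* v)) 0 tau.
Proof. by move=> H; apply: rdiff_segcontV => v _; exact: H. Qed.

Definition sqnorm F w := Re (F w) ^+ 2 + Im (F w) ^+ 2.

Lemma sqnormE F w : sqnorm F w = cabs (F w) ^+ 2.
Proof. by rewrite cabs_sqr. Qed.

Lemma rdiff_sqnorm F c (d : C) : cdiff F c d ->
  rdiff (sqnorm F) c (2 * Re ((F c)^* * d)) (2 * Im (F c * d^*)).
Proof.
move=> /cdiff_rdiff[H1 H2]; have := rdiffD (rdiffM H1 H1) (rdiffM H2 H2).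
rewrite [X in rdiff _ _ X](_ : _ = 2 * Re ((F c)^* * d)); last by rewrite !complexReImE; ring.
rewrite [X in rdiff _ _ _ X](_ : _ = 2 * Im (F c * d^*)); last by rewrite !complexReImE; ring.
by apply: rdiff_ext => w; rewrite /sqnorm !expr2.
Qed.

(** The field (Re F, - Im F) is divergence free and its flux through the horizontal sides cancels by
    periodicity. As [green_ineq] is one-sided, it is applied to the field and to its opposite. *)
Lemma circ_constant_Re F dF x d : 0 < d -> tau_periodic F ->
  (forall c, x <= Re c <= x + d -> cdiff F c (dF c)) ->
  circ (fun w => Re (F w)) (x + d) = circ (fun w => Re (F w)) x.
Proof.
move=> d0 PF HF.
pose X w := Re (F w); pose Y w := - Im (F w).
pose X' w := - X w; pose Y' w := - Y w.
have HX : rdiff_on (inrect x (x + d) 0 (0 + tau)) X (fun c => Re (dF c)) (fun c => - Im (dF c)).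
  by move=> c /andP[hc _]; exact: (cdiff_rdiff (HF c hc)).1.
have HY : rdiff_on (inrect x (x + d) 0 (0 + tau)) Y (fun c => - Im (dF c)) (fun c => - Re (dF c)).
  by move=> c /andP[hc _]; apply: rdiffN; exact: (cdiff_rdiff (HF c hc)).2.
have HXN : rdiff_on (inrect x (x + d) 0 (0 + tau)) X' (fun c => - Re (dF c)) (fun c => - - Im (dF c)).
  by move=> c hc; apply: rdiffN; exact: HX.
have HYN : rdiff_on (inrect x (x + d) 0 (0 + tau)) Y' (fun c => - - Im (dF c)) (fun c => - - Re (dF c)).
  by move=> c hc; apply: rdiffN; exact: HY.
have per (Z : C -> R) : (forall u, Z (u +i* (0 + tau)) = Z (u +i* 0)) ->
    segint (fun u => Z (u +i* (0 + tau)) - Z (u +i* 0)) x (x + d) = 0.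
  move=> HZ; rewrite (@eq_segint _ _ (fun=> 0)).
    by rewrite segint_cst ?mul0r// lerDl ltW.
  by move=> u _; rewrite HZ subrr.
have perF u : F (u +i* tau) = F (u +i* 0).
  by rewrite -[RHS]PF; congr F; apply: complex_eq; rewrite !complexReImE /= ?addr0 ?add0r.
have cX u : x <= u <= x + d -> segcont (fun v => X (u +i* v)) 0 tau.
  by move=> hu; apply: rdiff_circ => v; do 2 eexists; exact: (cdiff_rdiff (HF (u +i* v) hu)).1.
have c1 : segcont (fun v => X (x +i* v)) 0 tau by apply: cX; rewrite lexx lerDl ltW.
have c2 : segcont (fun v => X ((x + d) +i* v)) 0 tau by apply: cX; rewrite lexx lerDl ltW.

apply/eqP; rewrite eq_le; apply/andP; split.
  have := @green_ineq _ X Y _ _ _ _ (fun _ _ _ => 0) x 0 d tau d0 tau_gt0 HX HY.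
  rewrite /bdry per ?addr0 ?add0r; last by move=> u; rewrite /Y ?add0r perF.
  rewrite segintB// -/(circ X _) -/(circ X _) subr_le0; apply=> [? ? ?|c hc e e0]; first by rewrite ?addr0.
  exists 1 => // x' y' t _ _ _; rewrite subrr mul0r sub0r oppr_le0.
  by rewrite mulr_ge0 ?sqr_ge0// ltW.
have := @green_ineq _ X' Y' _ _ _ _ (fun _ _ _ => 0) x 0 d tau d0 tau_gt0 HXN HYN.
rewrite /bdry per ?addr0 ?add0r; last by move=> u; rewrite /Y' /Y ?add0r perF.
rewrite /X' segintB ?segintN//; [|exact: segcontN..].
rewrite -/(circ X _) -/(circ X _) opprK [- _ + _]addrC subr_le0; apply=> [? ? ?|c hc e e0]; first by rewrite ?addr0.
exists 1 => // x' y' t _ _ _; rewrite subrr mul0r sub0r oppr_le0.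
by rewrite mulr_ge0 ?sqr_ge0// ltW.
Qed.

Lemma circ_constant_Im F dF x d : 0 < d -> tau_periodic F ->
  (forall c, x <= Re c <= x + d -> cdiff F c (dF c)) ->
  circ (fun w => Im (F w)) (x + d) = circ (fun w => Im (F w)) x.
Proof.
move=> d0 PF HF.
have := @circ_constant_Re (fun w => (0 -i* 1) * F w) (fun c => 0 * F c + (0 -i* 1) * dF c) x d d0.
have E w : Re ((0 -i* 1) * F w) = Im (F w) by rewrite complexReImE /=; ring.
have E2 u : circ (fun w => Re ((0 -i* 1) * F w)) u = circ (fun w => Im (F w)) u.
  by apply: eq_segint => v _; rewrite E.
rewrite !E2; apply; first by move=> w; rewrite PF.
by move=> c hc; apply: cdiffM; [exact: cdiff_cst|exact: HF].
Qed.

Lemma nat_above (r : R) : exists n : nat, r < n%:R.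
Proof.
exists (Num.bound `|r|); apply: le_lt_trans (ler_norm r) _.
exact: archi_boundP.
Qed.

Section Convexity.
Variables (Q dQ : C -> C).
Hypothesis PQ : tau_periodic Q.
Hypothesis HQ : forall c, Re c < 0 -> cdiff Q c (dQ c).

Lemma sqnorm_segcont u : u < 0 -> segcont (fun v => sqnorm Q (u +i* v)) 0 tau.
Proof.
move=> u0; apply: rdiff_circ => v; do 2 eexists; apply: rdiff_sqnorm.
exact: HQ.
Qed.

(* The circle mean of w |-> Q(x - d + w) conj(Q(x + d - conj w)), a holomorphic
   function of w, is the same at Re w = 0 and at Re w = d. *)
Lemma circ_sqnorm_convex x d : 0 < d -> x + d < 0 ->
  2 * circ (sqnorm Q) x <= circ (sqnorm Q) (x - d) + circ (sqnorm Q) (x + d).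
Proof.
move=> d0 xd; have x0 : x < 0 by lra.
pose F w := Q ((x - d)%:C + w) * (Q ((x + d)%:C - w^*))^*.
pose dF c := dQ ((x - d)%:C + c) * 1 * (Q ((x + d)%:C - c^*))^* +
   Q ((x - d)%:C + c) * (dQ ((x + d)%:C - c^*) * (0 + -1))^*.
have HF c : 0 <= Re c <= 0 + d -> cdiff F c (dF c).
  move=> hc; apply: cdiffM.
    apply: (@cdiff_comp _ Q (fun w => (x - d)%:C + w)).
      by apply: HQ; rewrite complexReImE /=; lra.
    rewrite -[X in cdiff _ _ X]add0r; apply: cdiffD; [exact: cdiff_cst|exact: cdiff_id].
  apply: (@cdiff_conj _ (fun w => Q ((x + d)%:C - w))).
  apply: (@cdiff_comp _ Q (fun w => (x + d)%:C - w)).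
    by apply: HQ; rewrite !complexReImE /=; lra.
  apply: cdiffD; first exact: cdiff_cst.
  have := cdiffM (cdiff_cst (-1) c^*) (cdiff_id c^*); rewrite mul0r add0r mulr1.
  by apply: cdiff_ext => w; rewrite mulN1r.
have PF : tau_periodic F.
  move=> w; rewrite /F addrA PQ; congr (_ * (_)^*).
  by rewrite conjcD -[RHS]PQ; congr Q; apply: complex_eq; rewrite !complexReImE /=; ring.
have := circ_constant_Re d0 PF HF.
have -> : circ (fun w => Re (F w)) (0 + d) = circ (sqnorm Q) x.
  apply: eq_segint => v _; rewrite /F /sqnorm.
  have -> : (x - d)%:C + (0 + d) +i* v = x +i* v by apply: complex_eq; rewrite !complexReImE /=; ring.
  have -> : (x + d)%:C - ((0 + d) +i* v)^* = x +i* v by apply: complex_eq; rewrite !complexReImE /=; ring.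
  by rewrite !complexReImE; ring.
move=> ->.
have cF : segcont (fun v => Re (F (0 +i* v))) 0 tau.
  apply: (@rdiff_circ (fun w => Re (F w))) => v; do 2 eexists; apply: (proj1 (cdiff_rdiff (HF (0 +i* v) _))).
  by rewrite /= lexx add0r ltW.
have xd' : x - d < 0 by lra.
rewrite -segintZ// -segintD; [|exact: sqnorm_segcont..].
(* On Re w = 0 the integrands compare pointwise by 2 Re (z conj w) <= |z|^2 + |w|^2. *)
apply: le_segint.
- by apply: segcontM => //; exact: segcont_cst.
- by apply: segcontD; exact: sqnorm_segcont.
move=> v _; rewrite /F /sqnorm.
have -> : (x - d)%:C + 0 +i* v = (x - d) +i* v by apply: complex_eq; rewrite !complexReImE /=; ring.
have -> : (x + d)%:C - (0 +i* v)^* = (x + d) +i* v by apply: complex_eq; rewrite !complexReImE /=; ring.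
rewrite !complexReImE.
set a := Re _; set b := Re _; set a' := Im _; set b' := Im _.
have := sqr_ge0 (a - b); have := sqr_ge0 (a' - b'); rewrite !sqrrB; lra.
Qed.

Lemma circ_sqnorm_ge0 u : 0 <= circ (sqnorm Q) u.
Proof. by apply: segint_ge0 => v _; rewrite /sqnorm addr_ge0 ?sqr_ge0. Qed.

(* A midpoint convex function on a left half-line that is bounded near -oo is
   nondecreasing. *)
Lemma circ_sqnorm_nondecreasing M u0 :
  (forall u, u <= u0 -> circ (sqnorm Q) u <= M) ->
  forall x y, x <= y -> y < 0 -> circ (sqnorm Q) x <= circ (sqnorm Q) y.
Proof.
move=> HM x y; rewrite le_eqVlt => /predU1P[->//|xy] y0.
set N := circ (sqnorm Q); rewrite leNgt; apply/negP => Nyx.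
pose d := y - x; have d0 : 0 < d by rewrite subr_gt0.
pose g := N x - N y; have g0 : 0 < g by rewrite subr_gt0.
(* Convexity propagates the drop [g] to every step of length [d] further left, so [N] would grow at
   least linearly towards -oo, against the bound [M]. *)
have step n : g <= N (x - n.+1%:R * d) - N (x - n%:R * d).
  elim: n => [|n IH].
    rewrite mul0r subr0 mul1r /g.
    have := @circ_sqnorm_convex x d d0; rewrite -/N (_ : x + d = y); last by rewrite /d; ring.
    by move=> /(_ y0); lra.
  have := @circ_sqnorm_convex (x - n.+1%:R * d) d d0; rewrite -/N.
  rewrite (_ : x - n.+1%:R * d + d = x - n%:R * d); last by rewrite -[n.+1]addn1 natrD; ring.
  rewrite (_ : x - n.+1%:R * d - d = x - n.+2%:R * d); last by rewrite -[n.+2]addn1 natrD; ring.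
  have nd : 0 <= n%:R * d by rewrite mulr_ge0// ltW.
  have h : x - n%:R * d < 0 by lra.
  by move=> /(_ h); lra.
have grow n : N x + n%:R * g <= N (x - n%:R * d).
  elim: n => [|n IH]; first by rewrite !mul0r addr0 subr0.
  have := step n; have -> : n.+1%:R * g = n%:R * g + g by rewrite -[n.+1]addn1 natrD; ring.
  lra.
have [n1 hn1] := nat_above ((M - N x) / g).
have [n2 hn2] := nat_above ((x - u0) / d).
rewrite ltr_pdivrMr// in hn1; rewrite ltr_pdivrMr// in hn2.
have := grow (n1 + n2)%N; rewrite natrD !mulrDl.
have n1d : 0 <= n1%:R * d by rewrite mulr_ge0// ltW.
have n2g : 0 <= n2%:R * g by rewrite mulr_ge0// ltW.
have h : x - (n1%:R * d + n2%:R * d) <= u0 by lra.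
have := HM _ h; rewrite -/N; lra.
Qed.

End Convexity.
End CircleMeans.

(** * Lebesgue measure of the plane *)

Section PlaneMeasure.
Context {R : realType}.
Local Notation mu := (@lebesgue_measure R).
Local Notation mu2 := ((@lebesgue_measure R) \x (@lebesgue_measure R))%E.
Local Notation T := (measurableTypeR R).
Implicit Types (S U : set (T * T)).

(** Such a set is the countable union of the boxes with rational corners that it contains; boxes not
    contained in it are replaced by [set0]. *)
Lemma open_plane_measurable U :
  (forall p, U p -> exists2 r : R, 0 < r &
     forall q, `|q.1 - p.1| < r -> `|q.2 - p.2| < r -> U q) -> measurable U.
Proof.
move=> HU.
pose box (a b c d : rat) : set (T * T) :=
  `]ratr a, ratr b[%classic `*` `]ratr c, ratr d[%classic.
pose V a b c d : set (T * T) := if `[< box a b c d `<=` U >] then box a b c d else set0.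
have -> : U = \bigcup_a \bigcup_b \bigcup_c \bigcup_d V a b c d.
  apply/seteqP; split => [[x y] Uxy|p [a _ [b _ [c _ [d _]]]]]; last first.
    by rewrite /V; case: asboolP => // H /H.
  have [r r0 Hr] := HU _ Uxy.
  have [a] := @rat_in_itvoo R (x - r) x ltac:(lra); rewrite in_itv /= => /andP[a1 a2].
  have [b] := @rat_in_itvoo R x (x + r) ltac:(lra); rewrite in_itv /= => /andP[b1 b2].
  have [c] := @rat_in_itvoo R (y - r) y ltac:(lra); rewrite in_itv /= => /andP[c1 c2].
  have [d] := @rat_in_itvoo R y (y + r) ltac:(lra); rewrite in_itv /= => /andP[d1 d2].
  exists a => //; exists b => //; exists c => //; exists d => //.
  rewrite /V; case: asboolP => [_|].
    by split; rewrite /= in_itv /= ?a2 ?b1 ?c2 ?d1.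
  case=> -[u v] [/=]; rewrite !in_itv /= => /andP[u1 u2] /andP[v1 v2].
  by apply: Hr; rewrite /= ltr_norml; lra.
do 4!(apply: bigcupT_measurable_rat => ?).
rewrite /V; case: asboolP => _ //.
by apply: measurableX.
Qed.

(** Uniqueness of Lebesgue measure: the pushforward rescaled by |a| has the right value on intervals
    []x, y]]. A negative slope moves the closed end to the other side, which does not change the
    length. *)
Lemma lebesgue_affine (a g : R) (S : set T) : a != 0 -> measurable S ->
  mu [set x | S (a * x + g)] = (`|a|^-1%:E * mu S)%E.
Proof.
move=> a0 mS.
pose phi (x : T) : T := a * x + g.
have mphi : measurable_fun setT phi.
  by apply: measurable_funD => //; exact: measurable_funM.
have a0' : 0 < `|a| by rewrite normr_gt0.
pose m : {measure set T -> \bar R} := measure_function_pushforward__canonical__measure_function_Measure mu mphi.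
have Em A : m A = mu (phi @^-1` A) by [].
pose r : {nonneg R} := NngNum (normr_ge0 a).
have -> : mu S = mscale r m S.
  apply: lebesgue_measure_unique => // _ [[x y] _ <-] /=.
  rewrite /mscale Em.
  have [xy|yx] := ltP x y; last first.
    have E : `]x, y]%classic = set0 :> set T by rewrite set_itv_ge// bnd_simp -leNgt.
    by rewrite E preimage_set0 !measure0 mule0.
  have [ap|an] := ltP 0 a.
    have -> : phi @^-1` `]x, y] = `]((x - g) / a), ((y - g) / a)]%classic.
      apply/seteqP; split => z; rewrite /phi /= !in_itv /= ltr_pdivrMr// ler_pdivlMr//;
        rewrite (mulrC a z); lra.
    rewrite !lebesgue_measure_itv /= !lte_fin xy ltr_pM2r ?invr_gt0// ltrD2r xy.
    rewrite -!EFinD -EFinM; congr EFin; rewrite gtr0_norm//; field.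
    exact: lt0r_neq0.
  have {}an : a < 0 by rewrite lt_def eq_sym a0.
  have -> : phi @^-1` `]x, y] = `[((y - g) / a), ((x - g) / a)[%classic.
    apply/seteqP; split => z; rewrite /phi /= !in_itv /= ltr_ndivlMr// ler_ndivrMr//;
        rewrite (mulrC a z); lra.
  rewrite !lebesgue_measure_itv /= !lte_fin xy ltr_nM2r ?invr_lt0// ltrD2r xy.
  rewrite -!EFinD -EFinM; congr EFin; rewrite ltr0_norm//; field.
  exact: ltr0_neq0.
rewrite /mscale Em muleA -EFinM mulVf ?mul1e//.
by rewrite gt_eqF.
Qed.

Lemma product_measure_swap S : measurable S ->
  mu2 S = (\int[mu]_y (mu \o ysection S) y)%E.
Proof.
move=> mS.
pose m : {measure set (T * T) -> \bar R} := ((@lebesgue_measure R) \x^ (@lebesgue_measure R))%E.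
rewrite -[RHS]/(m S); apply: product_measure_unique => // A B mA mB.
exact: product_measure2E.
Qed.

Lemma measurable_affine (a b c : R) :
  measurable_fun setT (fun p : T * T => a * p.1 + b * p.2 + c).
Proof.
apply: measurable_funD => //; apply: measurable_funD.
  by apply: measurable_funM => //; exact: measurable_fst.
by apply: measurable_funM => //; exact: measurable_snd.
Qed.

Lemma measurable_affine_preimage (a b c a' b' c' : R) S : measurable S ->
  measurable [set p : T * T | S (a * p.1 + b * p.2 + c, a' * p.1 + b' * p.2 + c')].
Proof.
move=> mS.
have := measurable_fun_pair (measurable_affine a b c) (measurable_affine a' b' c').
by move=> /(_ measurableT _ mS); rewrite setTI.
Qed.

Lemma area_vertical_affine (b c e : R) S : b != 0 -> measurable S ->
  mu2 [set p | S (p.1, c * p.1 + b * p.2 + e)] = (`|b|^-1%:E * mu2 S)%E.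
Proof.
move=> b0 mS; rewrite /product_measure1 -ge0_integralZl//; last exact: measurable_fun_xsection.
apply: eq_integral => x _ /=.
rewrite -(lebesgue_affine (c * x + e) b0); last exact: measurable_xsection.
by congr (mu _); rewrite !xsectionE; apply/funext => y /=; congr (S (_, _)); ring.
Qed.

Lemma area_horizontal_affine (a c e : R) S : a != 0 -> measurable S ->
  mu2 [set p | S (a * p.1 + c * p.2 + e, p.2)] = (`|a|^-1%:E * mu2 S)%E.
Proof.
move=> a0 mS.
rewrite !product_measure_swap//; last first.
  have := measurable_affine_preimage a c e 0 1 0 mS.
  by rewrite [X in _ X -> _](_ : _ = [set p | S (a * p.1 + c * p.2 + e, p.2)])//;
    apply/seteqP; split => p /=; rewrite mul0r add0r mul1r addr0.
rewrite -ge0_integralZl//; last exact: measurable_fun_ysection.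
apply: eq_integral => y _ /=.
rewrite -(lebesgue_affine (c * y + e) a0); last exact: measurable_ysection.
by congr (mu _); rewrite !ysectionE; apply/funext => x /=; congr (S (_, _)); ring.
Qed.

End PlaneMeasure.

Section PlaneArea.
Context {R : realType}.
Local Notation mu := (@lebesgue_measure R).
Local Notation mu2 := ((@lebesgue_measure R) \x (@lebesgue_measure R))%E.
Local Notation T := (measurableTypeR R).
Local Notation C := R[i].
Implicit Types (S U : set (T * T)).

Definition topair (z : C) : T * T := (Re z, Im z).
Definition ofpair (p : T * T) : C := p.1 +i* p.2.

Lemma lebesgue_measure_oo (a b : R) : a <= b -> mu `]a, b[%classic = (b - a)%:E.
Proof.
move=> ab; rewrite lebesgue_measure_itv /= lte_fin -EFinD.
by move: ab; rewrite le_eqVlt => /predU1P[->|->//]; rewrite ltxx subrr.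
Qed.

Lemma area_rect (x x' y y' : R) : x <= x' -> y <= y' ->
  mu2 [set p | x < p.1 < x' /\ y < p.2 < y'] = ((x' - x) * (y' - y))%:E.
Proof.
move=> xx yy; rewrite (_ : [set p | _] = `]x, x'[%classic `*` `]y, y'[%classic).
  rewrite product_measure1E// EFinM.
  by congr (_ * _)%E; exact: lebesgue_measure_oo.
by apply/seteqP; split => p /=; rewrite !in_itv.
Qed.

(** When Re d is nonzero the similarity factors into a vertical and a horizontal affine map, of
    determinants Re d and |d|^2 / Re d; Fubini handles each through its one-dimensional slices. *)
Lemma area_complex_affine (d b : C) S : d != 0 -> measurable S ->
  mu2 [set p | S (topair (d * ofpair p + b))] = (((cabs d ^+ 2)^-1)%:E * mu2 S)%E.
Proof.
move=> d0 mS.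
have wR (d' b' : C) S' : Re d' != 0 -> measurable S' ->
   mu2 [set p | S' (topair (d' * ofpair p + b'))] = (((cabs d' ^+ 2)^-1)%:E * mu2 S')%E.
  case: d' b' => al be [ga de] /= al0 mS'.
  pose n2 := al ^+ 2 + be ^+ 2.
  have n20 : 0 < n2 by rewrite /n2 ltr_wpDr ?sqr_ge0// exprn_even_gt0.
  pose S1 : set (T * T) := [set q | S' (n2 / al * q.1 + (- be / al) * q.2 + (be * de / al + ga), q.2)].
  have mS1 : measurable S1.
    suff -> : S1 = [set q | S' (n2 / al * q.1 + (- be / al) * q.2 + (be * de / al + ga), 0 * q.1 + 1 * q.2 + 0)].
      exact: measurable_affine_preimage.
    by apply/funext => q /=; rewrite mul0r add0r mul1r addr0.
  rewrite (_ : [set p | _] = [set p | S1 (p.1, be * p.1 + al * p.2 + de)]).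
    rewrite area_vertical_affine// area_horizontal_affine ?mulf_neq0 ?invr_neq0//; last by rewrite gt_eqF.
    rewrite muleA -EFinM sqr_sqrtr; last exact: ltW.
    congr (_%:E * _)%E; rewrite normrM normfV (gtr0_norm n20) -/n2; field.
    by rewrite normr_eq0 al0 gt_eqF.
  apply/funext => -[x y] /=; rewrite /S1 /topair /=; congr (S' (_, _)); last by ring.
  by rewrite /n2; field.
have [a0|a0] := eqVneq (Re d) 0; last exact: wR.
(* For purely imaginary [d] both factors of [d = e * d2] have nonzero real part, so the first case
   applies twice. *)
pose e : C := 1 +i* 1; pose d2 := d / e.
have e0 : e != 0 by rewrite /e eq_complex /= negb_and oner_eq0.
have de : d = e * d2 by rewrite mulrC divfK.
have Re2 : Re d2 != 0.
  rewrite /d2 /e; case: d a0 d0 {de d2} => al be /= ->.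
  rewrite eq_complex /= eqxx /= expr1n => be0.
  by rewrite mul0r sub0r mulrN opprK mulf_neq0// mulf_neq0// invr_neq0// gt_eqF.
pose S1 : set (T * T) := [set q | S (topair (e * ofpair q + b))].
have mS1 : measurable S1.
  suff -> : S1 = [set q | S (1 * q.1 + -1 * q.2 + Re b, 1 * q.1 + 1 * q.2 + Im b)].
    exact: measurable_affine_preimage.
  by apply/funext => q /=; rewrite /S1 /topair /=; congr (S (_, _));
    rewrite !complexReImE /=; ring.
rewrite (_ : [set p | _] = [set p | S1 (topair (d2 * ofpair p + 0))]).
  rewrite wR// /S1 wR//; last by rewrite /= oner_eq0.
  rewrite muleA -EFinM; congr (_%:E * _)%E.
  transitivity ((cabs e ^+ 2 * cabs d2 ^+ 2)^-1); first by rewrite [RHS]invfM; exact: mulrC.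
  by rewrite -exprMn -cabsM -de.
apply/funext => p; rewrite /S1 /= de; congr (S (topair _)).
rewrite addr0 (_ : ofpair (topair _) = d2 * ofpair p); first by rewrite mulrA.
by apply: complex_eq.
Qed.

Lemma open_disc_measurable (c : C) (r : R) :
  measurable [set p : T * T | cabs (ofpair p - c) < r].
Proof.
apply: open_plane_measurable => p /= pr.
exists ((r - cabs (ofpair p - c)) / 2); first by rewrite divr_gt0// subr_gt0.
move=> q h1 h2.
rewrite (_ : ofpair q - c = (ofpair p - c) + (ofpair q - ofpair p)); last by ring.
rewrite (le_lt_trans (cabsD _ _))//.
have := cabs_le (ofpair q - ofpair p); rewrite !complexReImE /=; lra.
Qed.

(** The substitution x = cos y turns the integrand into 2 sin^2 y, with primitive y - sin y cos
    y. *)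
Lemma integral_circle : (\int[mu]_(x in `[(-1)%R, 1%R]) (2 * Num.sqrt (1 - x ^+ 2))%:E)%E = (@pi R)%:E.
Proof.
have D0 : derive1 (@cos R) = fun x => - sin x.
  by apply/funext => x; rewrite derive1E; exact: derive_val.
have cs : continuous (fun x : R => - sin x) by move=> x; apply: cvgN; exact: continuous_sin.
have := @integration_by_substitution_decreasing R cos (fun x => 2 * Num.sqrt (1 - x ^+ 2)) 0 pi (pi_ge0 _).
rewrite cos0 cospi D0 => ->.
- rewrite (_ : (\int[mu]_(x in _) _)%E = (\int[mu]_(x in `[0%R, pi]) (2 * sin x ^+ 2)%:E)%E); last first.
    apply: eq_integral => x; rewrite inE /= in_itv /= => x0.
    transitivity (2 * Num.sqrt (1 - cos x ^+ 2) * - - sin x)%:E => //.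
    rewrite opprK -sin2cos2 sqrtr_sqr ger0_norm ?sin_ge0_pi//.
    by rewrite expr2 mulrA.
  rewrite (@continuous_FTC2 _ _ (fun x => x - sin x * cos x)).
  + by rewrite sinpi sin0 !mul0r !subr0 sube0.
  + exact: pi_gt0.
  + apply: continuous_subspaceT => x; apply: cvgM; first exact: cvg_cst.
    by apply: cvgM; exact: continuous_sin.
  + split => [x _||]; last 2 first.
    * apply: cvg_at_right_filter; apply: cvgB => //; apply: cvgM; [exact: continuous_sin|exact: continuous_cos].
    * apply: cvg_at_left_filter; apply: cvgB => //; apply: cvgM; [exact: continuous_sin|exact: continuous_cos].
    by apply: derivableB => //; apply: derivableM.
  move=> x _; rewrite derive1E deriveB// deriveM// derive_id !derive_val /GRing.scale /=.
  by have := cos2Dsin2 x; rewrite expr2 expr2; lra.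
- move=> x y; rewrite !in_itv /= => h1 h2 xy.
  by rewrite ltr_cos ?in_itv.
- by move=> x _; exact: cs.
- by apply/cvg_ex; eexists; apply: cvg_at_right_filter; exact: cs.
- by apply/cvg_ex; eexists; apply: cvg_at_left_filter; exact: cs.
- split => [x _||]; first exact: derivable_cos.
  + by apply: cvg_at_right_filter; exact: continuous_cos.
  + by apply: cvg_at_left_filter; exact: continuous_cos.
- apply: continuous_subspaceT => x; apply: cvgM; first exact: cvg_cst.
  apply: (@continuous_comp _ _ _ (fun x : R => 1 - x ^+ 2) Num.sqrt).
    by apply: cvgB; [exact: cvg_cst|exact: exprn_continuous].
  exact: sqrt_continuous.
Qed.

Lemma area_unit_disc : mu2 [set p | cabs (ofpair p) < 1] = (@pi R)%:E.
Proof.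
rewrite -integral_circle integral_mkcond /product_measure1.
apply: eq_integral => x _ /=; rewrite patchE.
pose s := Num.sqrt (1 - x ^+ 2).
have -> : xsection [set p : T * T | cabs (ofpair p) < 1] x = `](- s), s[%classic.
  rewrite xsectionE; apply/funext => y /=; rewrite in_itv /= -ltr_norml.
  apply/propext; rewrite -sqrtr1 ltr_sqrt// -sqrtr_sqr /s; split => H.
    by rewrite ltr_sqrt; have := sqr_ge0 y; lra.
  have p : 0 < 1 - x ^+ 2 by rewrite -sqrtr_gt0 (le_lt_trans _ H)// sqrtr_ge0.
  by rewrite ltr_sqrt// in H; lra.
have s0 : 0 <= s by exact: sqrtr_ge0.
transitivity (mu `](- s), s[%classic) => //.
rewrite lebesgue_measure_oo; last by lra.
case: ifPn => [_|]; first by congr EFin; rewrite /s; ring.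
rewrite notin_setE /= in_itv /= => /negP H.
(* Outside [-1, 1] the root of a negative number is 0 by convention, which matches the empty
   slice. *)
suff -> : s = 0 by rewrite oppr0 subrr.
rewrite /s; apply/eqP; rewrite sqrtr_eq0 subr_le0.
rewrite -ler_norml in H; rewrite -ltNge in H.
by rewrite -[leRHS]real_normK ?num_real// ltW// exprn_egt1.
Qed.

Lemma area_disc (c : C) (r : R) : 0 < r ->
  mu2 [set p | cabs (ofpair p - c) < r] = (pi * r ^+ 2)%:E.
Proof.
move=> r0.
have m1 : measurable [set p : T * T | cabs (ofpair p) < 1].
  suff -> : [set p : T * T | cabs (ofpair p) < 1] = [set p | cabs (ofpair p - 0) < 1].
    exact: open_disc_measurable.
  by apply/seteqP; split => p; rewrite /mkset subr0.
pose d : C := (r^-1)%:C.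
have cd : cabs d = r^-1 by rewrite cabs_real gtr0_norm ?invr_gt0.
have d0 : d != 0 by rewrite -cabs_gt0 cd invr_gt0.
rewrite (_ : [set p | _] = [set p | [set p : T * T | cabs (ofpair p) < 1] (topair (d * ofpair p + - (d * c)))]).
  rewrite area_complex_affine// area_unit_disc cd -EFinM; congr EFin.
  by field; rewrite gt_eqF.
apply/funext => p; rewrite /mkset (_ : ofpair (topair _) = d * (ofpair p - c)).
  by rewrite cabsM cd mulrC ltr_pdivrMr// mul1r.
by rewrite mulrBr; apply: complex_eq.
Qed.

End PlaneArea.

(** * Inner area of images *)

Section InnerArea.
Context {R : realType}.
Local Notation mu2 := ((@lebesgue_measure R) \x (@lebesgue_measure R))%E.
Local Notation T := (measurableTypeR R).
Local Notation C := R[i].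
Implicit Types (S : set C) (K M : set (T * T)).

(** An infinite measure is sent to 0 by [fine]; comparisons are therefore made inside a set [M] of
    finite measure. *)
Definition plane_area K : R := fine (mu2 K).

(* The inner area is superadditive on arbitrary sets, so that no measurability
   of images of rectangles is needed. *)
Definition inner_area S : R :=
  sup [set plane_area K | K in [set K | measurable K /\ forall p, K p -> S (ofpair p)]].

Section Bounded.
Variable M : set (T * T).
Hypotheses (mM : measurable M) (finM : (mu2 M < +oo)%E).

Definition within_set S := forall p, S (ofpair p) -> M p.

Lemma plane_area_le K : measurable K -> K `<=` M -> plane_area K <= plane_area M.
Proof.
move=> mK KM; rewrite /plane_area fine_le//.
- rewrite ge0_fin_numE//; apply: le_lt_trans finM.
  by apply: le_measure => //; rewrite inE.
- by rewrite ge0_fin_numE.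
- by apply: le_measure => //; rewrite inE.
Qed.

Lemma fin_sub K : measurable K -> K `<=` M -> mu2 K \is a fin_num.
Proof.
move=> mK KM; rewrite ge0_fin_numE//; apply: le_lt_trans finM.
by apply: le_measure => //; rewrite inE.
Qed.

Let pieces S := [set plane_area K | K in [set K | measurable K /\ forall p, K p -> S (ofpair p)]].

Let has_sup_pieces S : within_set S -> has_sup (pieces S).
Proof.
move=> SM; split.
  by exists (plane_area set0), set0 => //; split.
exists (plane_area M) => _ [K [mK KS] <-]; apply: plane_area_le => //.
by move=> p /KS/SM.
Qed.

Lemma inner_area_ge K S : within_set S -> measurable K ->
  (forall p, K p -> S (ofpair p)) -> plane_area K <= inner_area S.
Proof.
move=> SM mK KS; apply: ub_le_sup; first by case: (has_sup_pieces SM).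
by exists K.
Qed.

Lemma inner_area_ge0 S : within_set S -> 0 <= inner_area S.
Proof.
move=> SM; apply: le_trans (inner_area_ge SM measurable0 _) => //.
by rewrite /plane_area measure0.
Qed.

(** Almost optimal measurable pieces of two disjoint sets are disjoint, and their union is a piece
    of the larger set. *)
Lemma inner_area_add S1 S2 S : within_set S ->
  S1 `<=` S -> S2 `<=` S -> (forall z, S1 z -> ~ S2 z) ->
  inner_area S1 + inner_area S2 <= inner_area S.
Proof.
move=> SM S1S S2S S12.
have M1 : within_set S1 by move=> p /S1S/SM.
have M2 : within_set S2 by move=> p /S2S/SM.
apply/ler_addgt0Pl => e e0; rewrite addrC.
have e20 : 0 < e / 2 by rewrite divr_gt0.
have [_ [K1 [mK1 KS1] <-] H1] := sup_adherent e20 (has_sup_pieces M1).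
have [_ [K2 [mK2 KS2] <-] H2] := sup_adherent e20 (has_sup_pieces M2).
have KM1 : K1 `<=` M by move=> p /KS1/M1.
have KM2 : K2 `<=` M by move=> p /KS2/M2.
have : plane_area (K1 `|` K2) = plane_area K1 + plane_area K2.
  rewrite /plane_area measureU//; first by rewrite fineD// fin_sub.
  by apply/seteqP; split => // p [/KS1 h1 /KS2 h2]; exact: (S12 _ h1 h2).
have : plane_area (K1 `|` K2) <= inner_area S.
  apply: inner_area_ge => //; first exact: measurableU.
  by move=> p [/KS1/S1S|/KS2/S2S].
rewrite -/(inner_area S1) -/(inner_area S2) in H1 H2.
lra.
Qed.

Lemma inner_area_le S : within_set S -> inner_area S <= plane_area M.
Proof.
move=> SM; apply: ge_sup; first by case: (has_sup_pieces SM).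
move=> _ [K [mK KS] <-]; apply: plane_area_le => //.
by move=> p /KS/SM.
Qed.

End Bounded.

(** The tangent map of [G] at [c] sends a slightly shrunk rectangle to a measurable set [K] of
    explicit area. Each point of [K] is a value of [G] on the full rectangle: the local inverse [L]
    brings it back within the removed margin. Differentiability of [L] at the single point [G c] is
    enough for this. *)
Lemma image_density (G L : C -> C) (c d : C) (U : set C) M (l k : R) :
  measurable M -> (mu2 M < +oo)%E ->
  0 < l -> 0 < k -> d != 0 -> L (G c) = c -> cdiff L (G c) d^-1 ->
  (exists2 r, 0 < r & forall h, cabs h < r ->
     [/\ U (G c + h), Re (L (G c + h)) < 0 & G (L (G c + h)) = G c + h]) ->
  forall e, 0 < e -> exists2 r, 0 < r & forall x y t, 0 < t -> t < r ->
    inrect x (x + t * l) y (y + t * k) c ->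
    forall S : set C, within_set M S ->
    (forall w, x <= Re w < x + t * l -> y <= Im w < y + t * k -> Re w < 0 ->
       U (G w) -> S (G w)) ->
    cabs d ^+ 2 * (t * l * (t * k)) - e * t ^+ 2 <= inner_area S.
Proof.
move=> mM finM l0 k0 d0 Lc HL [r1 r10 Hr1] e e0.
have D0 : 0 < cabs d by rewrite cabs_gt0.
have lk0 : 0 < l + k by rewrite addr_gt0.
pose A := cabs d ^+ 2 * (l * k).
have A0 : 0 < A by rewrite /A mulr_gt0 ?exprn_gt0// mulr_gt0.
(* Relative margin: shrinking by the factor 1 - 2s loses at most [4 * s * A * t ^+ 2], hence at most
   [e * t ^+ 2]; the bound 1/4 keeps the shrunk rectangle nondegenerate. *)
pose s := Num.min (1 / 4) (e / (4 * A)).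
have s0 : 0 < s by rewrite /s lt_min !divr_gt0// mulr_gt0.
have s4 : s <= 1 / 4 by rewrite /s ge_min lexx.
have sA : 4 * s * A <= e.
  have : s <= e / (4 * A) by rewrite /s ge_min lexx orbT.
  rewrite ler_pdivlMr ?mulr_gt0//; lra.
pose m := Num.min l k.
have m0 : 0 < m by rewrite /m lt_min l0.
have ml : m <= l by rewrite /m ge_min lexx.
have mk : m <= k by rewrite /m ge_min lexx orbT.
(* Increments [h] have modulus at most [cabs d * (t * (l + k))], so the error of [L] is at most the
   margin [s * (t * m)]. *)
pose e1 := s * m / (cabs d * (l + k)).
have e10 : 0 < e1 by rewrite /e1 divr_gt0 ?mulr_gt0.
have [r2 r20 Hr2] := HL _ e10.
exists (Num.min r1 r2 / (cabs d * (l + k))).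
  by rewrite divr_gt0 ?mulr_gt0// lt_min r10.
move=> x y t t0; rewrite ltr_pdivlMr ?mulr_gt0// => tr hc S SM HS.
case/andP: hc => /andP[c1 c2] /andP[c3 c4].
have tl : 0 < t * l by rewrite mulr_gt0.
have tk : 0 < t * k by rewrite mulr_gt0.
have stm : s * (t * m) <= s * (t * l) /\ s * (t * m) <= s * (t * k).
  by split; rewrite ler_pM2l// ler_pM2l.
case: stm => stl stk.
have stl0 : 0 < s * (t * l) by rewrite mulr_gt0.
have stk0 : 0 < s * (t * k) by rewrite mulr_gt0.
have stl1 : s * (t * l) <= 1 / 4 * (t * l) by rewrite ler_pM2r.
have stk1 : s * (t * k) <= 1 / 4 * (t * k) by rewrite ler_pM2r.
pose Q : set (T * T) := [set p | x + s * (t * l) < p.1 < x + t * l - s * (t * l) /\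
   y + s * (t * k) < p.2 < y + t * k - s * (t * k)].
have mQ : measurable Q.
  rewrite (_ : Q = `]x + s * (t * l), x + t * l - s * (t * l)[%classic `*`
     `]y + s * (t * k), y + t * k - s * (t * k)[%classic).
    by apply: measurableX; exact: measurable_itv.
  by apply/seteqP; split => p /=; rewrite !in_itv.
have aQ : mu2 Q = ((1 - 2 * s) ^+ 2 * (t * l * (t * k)))%:E.
  by rewrite area_rect; [congr EFin; ring|lra|lra].
pose K : set (T * T) := [set p | Q (topair (d^-1 * ofpair p + (c - d^-1 * G c)))].
have mK : measurable K.
  suff -> : K = [set p | Q (Re d^-1 * p.1 + (- Im d^-1) * p.2 + Re (c - d^-1 * G c),
     Im d^-1 * p.1 + Re d^-1 * p.2 + Im (c - d^-1 * G c))].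
    exact: measurable_affine_preimage.
  apply/funext => p; rewrite /K /mkset; congr (Q (_, _)).
    by rewrite !complexReImE /=; ring.
  by rewrite !complexReImE /=; ring.
have aK : plane_area K = cabs d ^+ 2 * ((1 - 2 * s) ^+ 2 * (t * l * (t * k))).
  rewrite /plane_area /K area_complex_affine ?invr_neq0// aQ -EFinM /= cabsV.
  by rewrite exprVn invrK.
have KS p : K p -> S (ofpair p).
  rewrite /K /mkset; set q := _ + (c - _) => -[/andP[q1 q2] /andP[q3 q4]].
  pose h := d * (q - c).
  have ph : ofpair p = G c + h.
    by rewrite /h /q; field.
  clearbody q; rewrite /topair /= in q1 q2 q3 q4.
  have qc : cabs (q - c) <= t * (l + k).
    rewrite (le_trans (cabs_le _))// !complexReImE mulrDr lerD// ler_norml; lra.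
  have hb : cabs h <= cabs d * (t * (l + k)) by rewrite /h cabsM ler_pM2l.
  have := le_lt_trans hb; move=> /(_ (Num.min r1 r2)).
  rewrite mulrCA => /(_ tr); rewrite lt_min => /andP[h1 h2].
  have [Uh Lh Gh] := Hr1 _ h1.
  have := Hr2 _ h2; rewrite Lc.
  set w := L (G c + h) in Lh Gh *.
  have -> : w - c - d^-1 * h = w - q.
    by rewrite /h mulrA mulVf// mul1r; ring.
  move=> hw.
  have {}hw : cabs (w - q) <= s * (t * m).
    rewrite (le_trans hw)// (le_trans (ler_wpM2l (ltW e10) hb))// /e1.
    rewrite le_eqVlt; apply/orP; left; apply/eqP; field.
    by rewrite !gt_eqF.
  have := le_trans (Re_le_cabs _) hw; have := le_trans (Im_le_cabs _) hw.
  rewrite !complexReImE !ler_norml => /andP[w1 w2] /andP[w3 w4].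
  rewrite ph -Gh; apply: HS => //; last by rewrite Gh.
    by apply/andP; split; lra.
  by apply/andP; split; lra.
apply: le_trans (inner_area_ge mM finM SM mK KS).
rewrite aK.
have tt : 0 < t ^+ 2 by rewrite exprn_gt0.
have : 4 * s * A * t ^+ 2 <= e * t ^+ 2 by rewrite ler_pM2r.
have : 0 <= A * t ^+ 2 * s ^+ 2 by rewrite mulr_ge0 ?sqr_ge0// mulr_ge0// ltW.
rewrite /A; lra.
Qed.

End InnerArea.

(** * Areas of images of rectangles under the logarithmic parametrisation *)

Section ConformalArea.
Context {R : realType}.
Local Notation mu2 := ((@lebesgue_measure R) \x (@lebesgue_measure R))%E.
Local Notation T := (measurableTypeR R).
Local Notation C := R[i].
Local Notation tau := (pi *+ 2 : R).
Implicit Types (w z c : C).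
Variables (g f g' : C -> C) (Om : set C).
Hypothesis Hg : forall z, cabs z < 1 -> cdiff g z (g' z).
Hypothesis Hf : forall x, Om x -> exists d, cdiff f x d.
Hypothesis gOm : forall z, cabs z < 1 -> Om (g z).
Hypothesis fD : forall x, Om x -> cabs (f x) < 1.
Hypothesis gK : forall z, cabs z < 1 -> f (g z) = z.
Hypothesis fK : forall x, Om x -> g (f x) = x.
Hypothesis Om_open : forall x, Om x ->
  exists2 r : R, 0 < r & forall h, cabs h < r -> Om (x + h).
Let M : set (T * T) := [set p | Om (ofpair p)].
Hypothesis mM : measurable M.
Hypothesis finM : (mu2 M < +oo)%E.

Definition logcoord (w : C) := g (cexp w).
Definition dlogcoord (w : C) := g' (cexp w) * cexp w.
Local Notation G := logcoord.
Local Notation dG := dlogcoord.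

Lemma cexp_disc w : Re w < 0 -> cabs (cexp w) < 1.
Proof. by rewrite cabs_cexp expR_lt1. Qed.

Lemma cdiff_logcoord w : Re w < 0 -> cdiff G w (dG w).
Proof.
move=> w0; apply: (@cdiff_comp _ g cexp); last exact: cdiff_cexp.
exact/Hg/cexp_disc.
Qed.

Lemma derivative_inverse z d : cabs z < 1 -> cdiff f (g z) d -> d * g' z = 1.
Proof.
move=> z1 Hd.
have H := cdiff_comp Hd (Hg z1).
apply: (cdiff_uniq H) => e e0.
exists (1 - cabs z); first by rewrite subr_gt0.
move=> h hz; rewrite !gK//.
  rewrite (_ : z + h - z - 1 * h = 0) ?cabs0 ?mulr_ge0 ?cabs_ge0// ?ltW//; ring.
by rewrite (le_lt_trans (cabsD _ _))//; lra.
Qed.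

Lemma dlogcoord_neq0 c : Re c < 0 -> dG c != 0.
Proof.
move=> c0; rewrite mulf_neq0 ?cexp_neq0//.
have [d Hd] := Hf (gOm (cexp_disc c0)).
have /eqP := derivative_inverse (cexp_disc c0) Hd.
by apply: contraTneq => ->; rewrite mulr0 eq_sym oner_eq0.
Qed.

Lemma clog_1 : clog (1 : C) = 0.
Proof.
rewrite /clog /= mul0r atan0 expr0n /= addr0 expr1n ln1 mul0r.
by apply: complex_eq.
Qed.

(** A branch of log f near [G c] is c + clog (e^{-c} f): its argument is close to 1, so the
    logarithm on the right half-plane serves at every [c]. *)
Lemma logcoord_local_inverse c : Re c < 0 -> exists L : C -> C,
  [/\ L (G c) = c, cdiff L (G c) (dG c)^-1 &
   exists2 r : R, 0 < r & forall h, cabs h < r ->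
     [/\ Om (G c + h), Re (L (G c + h)) < 0 & G (L (G c + h)) = G c + h]].
Proof.
move=> c0; have z1 := cexp_disc c0; have z0 := cexp_neq0 c.
pose z := cexp c.
have OG : Om (G c) by exact: gOm.
have [d Hd] := Hf OG.
have dg := derivative_inverse z1 Hd.
have fG : f (G c) = z by rewrite /logcoord gK.
exists (fun x => c + clog (z^-1 * f x)); split.
- by rewrite fG mulVf// clog_1 addr0.
- have -> : (dG c)^-1 = 0 + 1 * (0 * f (G c) + z^-1 * d).
    rewrite mul0r !add0r mul1r /dlogcoord invfM mulrC; congr (_ * _).
    have g0 : g' (cexp c) != 0.
      by apply: contra_eq_neq dg => ->; rewrite mulr0 eq_sym oner_eq0.
    by apply: (mulIf g0); rewrite mulVf.
  apply: cdiffD; first exact: cdiff_cst.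
  apply: (@cdiff_comp _ clog (fun x => z^-1 * f x)).
    by rewrite fG mulVf//; exact: cdiff_clog1.
  by apply: cdiffM => //; exact: cdiff_cst.
have [r1 r10 Hr1] := Om_open OG.
have zp : 0 < cabs z by rewrite cabs_gt0.
have [r2 r20 Hr2] := cdiff_cts Hd zp.
exists (Num.min r1 r2); first by rewrite lt_min r10.
move=> h; rewrite lt_min => /andP[/Hr1 h1 /Hr2 h2].
have fh := fD h1.
set x := G c + h in h1 h2 fh *.
have ReP : 0 < Re (z^-1 * f x).
  have : cabs (z^-1 * f x - 1) < 1.
    rewrite (_ : _ - 1 = z^-1 * (f x - f (G c))); last by rewrite fG; field.
    by rewrite cabsM cabsV mulrC ltr_pdivrMr// mul1r.
  move=> /(le_lt_trans (Re_le_cabs _)); rewrite complexReImE [Re (- 1)]cReN ltr_norml => /andP[+ _].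
  by rewrite [Re 1]/=; lra.
have E : cexp (c + clog (z^-1 * f x)) = f x.
  by rewrite cexpD clogK// mulrA mulfV// mul1r.
split => //; first by rewrite -expR_lt1 -cabs_cexp E.
by rewrite /logcoord E fK.
Qed.

(** Half-open sides make adjacent rectangles disjoint; the clause [Re w < 0] keeps the image in the
    domain whatever the rectangle. *)
Definition rect_image (U : set C) (x x' y y' : R) : set C :=
  [set z | U z /\ exists w, [/\ x <= Re w < x', y <= Im w < y', Re w < 0 & G w = z]].

Lemma rect_image_within U x x' y y' : within_set M (rect_image U x x' y y').
Proof. by move=> p [_ [w [_ _ w0 e]]]; rewrite /M /mkset -e; exact/gOm/cexp_disc. Qed.

Lemma logcoord_inj w w' : Re w < 0 -> Re w' < 0 -> `|Im w - Im w'| < tau ->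
  G w = G w' -> w = w'.
Proof.
move=> w0 w0' ww' e; apply: cexp_inj => //.
by rewrite -(gK (cexp_disc w0)) -(gK (cexp_disc w0')); congr f.
Qed.

(** The area of the image with the weight 1_U + 1. [U = set0] serves the energy estimate, a disc
    serves the overlap estimate. *)
Definition annulus_area U x x' y y' :=
  inner_area (rect_image U x x' y y') + inner_area (rect_image setT x x' y y').

(** Height at most 2 pi together with half-open sides gives a difference of imaginary parts strictly
    below 2 pi, so the parametrisation is injective on the union. *)
Lemma rect_image_splitH U x x' x'' y y' : x <= x' -> x' <= x'' -> y' - y <= tau ->
  inner_area (rect_image U x x' y y') + inner_area (rect_image U x' x'' y y') <=
  inner_area (rect_image U x x'' y y').
Proof.
move=> xx xx' yy; apply: (inner_area_add mM finM).
- exact: rect_image_within.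
- move=> z [Uz [w [/andP[w1 w2] w3 w4 w5]]]; split => //; exists w; split => //.
  by rewrite w1 (lt_le_trans w2).
- move=> z [Uz [w [/andP[w1 w2] w3 w4 w5]]]; split => //; exists w; split => //.
  by rewrite w2 (le_trans xx).
move=> z [_ [w [/andP[w1 w2] /andP[w3 w4] w5 <-]]] [_ [w' [/andP[w1' w2'] /andP[w3' w4'] w5']]].
move=> /logcoord_inj => /(_ w5' w5) ww.
have {}ww : w' = w by apply: ww; rewrite ltr_norml; lra.
by move: w1'; rewrite ww leNgt w2.
Qed.

Lemma rect_image_splitV U x x' y y' y'' : y <= y' -> y' <= y'' -> y'' - y <= tau ->
  inner_area (rect_image U x x' y y') + inner_area (rect_image U x x' y' y'') <=
  inner_area (rect_image U x x' y y'').
Proof.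
move=> yy yy' yt; apply: (inner_area_add mM finM).
- exact: rect_image_within.
- move=> z [Uz [w [w3 /andP[w1 w2] w4 w5]]]; split => //; exists w; split => //.
  by rewrite w1 (lt_le_trans w2).
- move=> z [Uz [w [w3 /andP[w1 w2] w4 w5]]]; split => //; exists w; split => //.
  by rewrite w2 (le_trans yy).
move=> z [_ [w [/andP[w1 w2] /andP[w3 w4] w5 <-]]] [_ [w' [/andP[w1' w2'] /andP[w3' w4'] w5']]].
move=> /logcoord_inj => /(_ w5' w5) ww.
have {}ww : w' = w by apply: ww; rewrite ltr_norml; lra.
by move: w3'; rewrite ww leNgt w4.
Qed.

Definition open_set (U : set C) := forall z, U z ->
  exists2 r : R, 0 < r & forall h, cabs h < r -> U (z + h).

Lemma rect_image_density U c l k : open_set U -> U (G c) -> Re c < 0 -> 0 < l -> 0 < k ->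
  forall e, 0 < e -> exists2 r, 0 < r & forall x y t, 0 < t -> t < r ->
    inrect x (x + t * l) y (y + t * k) c ->
    cabs (dG c) ^+ 2 * (t * l * (t * k)) - e * t ^+ 2 <=
    inner_area (rect_image U x (x + t * l) y (y + t * k)).
Proof.
move=> oU Uc c0 l0 k0 e e0.
have [L [Lc HL [r1 r10 Hr1]]] := logcoord_local_inverse c0.
have [r2 r20 Hr2] := oU _ Uc.
have [|r r0 Hr] := @image_density _ G L c (dG c) U M l k mM finM l0 k0 (dlogcoord_neq0 c0) Lc HL _ e e0.
  exists (Num.min r1 r2); first by rewrite lt_min r10.
  by move=> h; rewrite lt_min => /andP[/Hr1[_ h1 h2] /Hr2 h3].
exists r => // x y t t0 tr hc; apply: (Hr x y t t0 tr hc); first exact: rect_image_within.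
by move=> w h1 h2 h3 Uw; split => //; exists w.
Qed.

(** Openness of [U] keeps the image of a small rectangle in [U] when [G c] is in it; otherwise the
    part in [U] is only bounded below by 0. *)
Lemma annulus_area_density U c l k : open_set U -> Re c < 0 -> 0 < l -> 0 < k ->
  forall e, 0 < e -> exists2 r, 0 < r & forall x y t, 0 < t -> t < r ->
    inrect x (x + t * l) y (y + t * k) c ->
    (`[< U (G c) >]%:R + 1) * cabs (dG c) ^+ 2 * (t * l * (t * k)) - e * t ^+ 2 <=
    annulus_area U x (x + t * l) y (y + t * k).
Proof.
move=> oU c0 l0 k0 e e0; have e20 : 0 < e / 2 by rewrite divr_gt0.
have oT : open_set setT by move=> z _; exists 1.
have [r r0 Hr] := rect_image_density oT I c0 l0 k0 e20.
case: asboolP => [Uc|nU].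
  have [s s0 Hs] := rect_image_density oU Uc c0 l0 k0 e20.
  exists (Num.min r s); first by rewrite lt_min r0.
  move=> x y t t0; rewrite lt_min => /andP[tr ts] hc.
  have := Hr x y t t0 tr hc; have := Hs x y t t0 ts hc; rewrite /annulus_area /=; lra.
exists r => // x y t t0 tr hc.
have := Hr x y t t0 tr hc; rewrite /annulus_area.
have := inner_area_ge0 mM finM (@rect_image_within U x (x + t * l) y (y + t * k)).
have := sqr_ge0 t; rewrite /= => t2.
have : 0 <= e / 2 * t ^+ 2 by rewrite mulr_ge0// ltW.
lra.
Qed.

Lemma rdiff_freeze (al : C -> R) (v : R) c A B :
  rdiff al (v +i* Im c) A B -> rdiff (fun w => al (v +i* Im w)) c 0 B.
Proof.
move=> H e e0; have [r r0 Hr] := H e e0; exists r => // h hr.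
have i1 : cabs (0 +i* Im h) <= cabs h.
  by rewrite /= expr0n /= add0r sqrtr_sqr Im_le_cabs.
have := Hr _ (le_lt_trans i1 hr) => /=.
rewrite (_ : v +i* Im c + 0 +i* Im h = v +i* Im (c + h)); last first.
  by apply: complex_eq; rewrite !complexReImE /= ?addr0.
by rewrite mulr0 mul0r => /le_trans; apply; rewrite ler_wpM2l// ltW.
Qed.

(** * Weighted area of a ring bounded below by a flux minus a radial integral *)

Section Ring.
Variables (U : set C) (X XA XB Y YA YB al alA alB : C -> R).
Hypothesis oU : open_set U.
Hypothesis HX : rdiff_on (fun c => Re c < 0) X XA XB.
Hypothesis HY : rdiff_on (fun c => Re c < 0) Y YA YB.
Hypothesis Hal : rdiff_on (fun c => Re c < 0) al alA alB.
Hypothesis PY : forall w, Y (w + (0 +i* tau)) = Y w.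
Hypothesis pointwise : forall c, Re c < 0 ->
  XA c + YB c - al c <= (`[< U (G c) >]%:R + 1) * cabs (dG c) ^+ 2.

(** Compactness of the period segment makes the pointwise continuity of [al] uniform in [y]. *)
Lemma tube (v e : R) : v < 0 -> 0 < e -> exists2 r : R, 0 < r & forall u y : R, `|u - v| < r ->
  0 <= y <= tau -> `|al (u +i* y) - al (v +i* y)| < e.
Proof.
move=> v0 e0; have e20 : 0 < e / 2 by rewrite divr_gt0.
have cov : \forall u \near v, `[0, tau] `<=` (fun y => `|al (u +i* y) - al (v +i* y)| < e).
  have /compact_near_coveringP H := @segment_compact R 0 tau.
  apply: (H R (nbhs v) (fun u y => `|al (u +i* y) - al (v +i* y)| < e)) => y _.
  have [r r0 Hr] := rdiff_cts (@Hal (v +i* y) v0) e20.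
  exists (ball y (r / 2), ball v (r / 2)).
    by split; apply: nbhsx_ballx; rewrite divr_gt0.
  move=> [y' u] [/= h1 h2]; rewrite /ball /= in h1 h2.
  have K u' : `|v - u'| < r / 2 -> `|al (u' +i* y') - al (v +i* y)| < e / 2.
    move=> hu; have := Hr ((u' - v) +i* (y' - y)).
    rewrite (_ : v +i* y + _ = u' +i* y'); last by apply: complex_eq; rewrite !complexReImE /=; ring.
    apply; rewrite (le_lt_trans (cabs_le _))//= distrC.
    by rewrite (distrC y' y); lra.
  have := K u h2; have := K v; rewrite subrr normr0 divr_gt0// => /(_ isT).
  by rewrite !ltr_norml; lra.
move/nbhs_ballP: cov => [d /= d0 Hd].
exists d => // u y hu hy; apply: (Hd u); last by rewrite /= in_itv.
by rewrite /ball /= distrC.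
Qed.

Lemma annulus_area_splitH x x' x'' y y' : x <= x' -> x' <= x'' -> y' - y <= tau ->
  annulus_area U x x' y y' + annulus_area U x' x'' y y' <= annulus_area U x x'' y y'.
Proof.
move=> h1 h2 h3; have := rect_image_splitH U h1 h2 h3.
have := rect_image_splitH setT h1 h2 h3; rewrite /annulus_area; lra.
Qed.

Lemma annulus_area_splitV x x' y y' y'' : y <= y' -> y' <= y'' -> y'' - y <= tau ->
  annulus_area U x x' y y' + annulus_area U x x' y' y'' <= annulus_area U x x' y y''.
Proof.
move=> h1 h2 h3; have := rect_image_splitV U x x' h1 h2 h3.
have := rect_image_splitV setT x x' h1 h2 h3; rewrite /annulus_area; lra.
Qed.

Lemma circ_segcont (Z ZA ZB : C -> R) (u : R) :
  rdiff_on (fun c => Re c < 0) Z ZA ZB -> u < 0 -> segcont (fun y => Z (u +i* y)) 0 tau.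
Proof. by move=> H u0; apply: rdiff_circ => y; do 2 eexists; exact: H. Qed.

(* Near the circle of radius e^v the function al is replaced by its values on
   that circle, for which the u-integral is explicit; this avoids integrals in
   two variables. *)
Lemma annulus_frozen (v e : R) : v < 0 -> 0 < e -> exists2 d : R, 0 < d &
  forall p q, p <= v <= q -> p < q -> q < 0 -> q - p < d ->
  circ X q - circ X p - (q - p) * (circ al v + e * tau) <= annulus_area U p q 0 tau.
Proof.
move=> v0 e0; have [d d0 Hd] := tube v0 e0; exists d => // p q /andP[pv vq] pq q0 qpd.
pose X' w := X w - Re w * (al (v +i* Im w) + e).
pose XA' c := XA c - (1 * (al (v +i* Im c) + e) + Re c * (0 + 0)).
pose XB' c := XB c - (0 * (al (v +i* Im c) + e) + Re c * (alB (v +i* Im c) + 0)).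
have l0 : 0 < q - p by rewrite subr_gt0.
have t0 := @tau_gt0 R.
have pqE : p + (q - p) = q by rewrite addrC subrK.
have HX' : rdiff_on (inrect p (p + (q - p)) 0 (0 + tau)) X' XA' XB'.
  move=> c /andP[/andP[c1 c2] _]; rewrite pqE in c2.
  apply: rdiffB; first by apply: HX; exact: le_lt_trans q0.
  apply: rdiffM; first exact: rdiff_Re.
  apply: rdiffD; last exact: rdiff_cst.
  by apply: rdiff_freeze; exact: Hal.
have HY' : rdiff_on (inrect p (p + (q - p)) 0 (0 + tau)) Y YA YB.
  move=> c /andP[/andP[c1 c2] _]; rewrite pqE in c2.
  by apply: HY; exact: le_lt_trans q0.
pose Phi x y t := annulus_area U x (x + t * (q - p)) y (y + t * tau).
have := @green_ineq _ X' Y XA' XB' YA YB Phi p 0 (q - p) tau l0 t0 HX' HY'.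
have -> : bdry X' Y p (p + (q - p)) 0 (0 + tau) =
    circ X q - circ X p - (q - p) * (circ al v + e * tau).
  rewrite /bdry pqE add0r.
  have -> : segint (fun u => Y (u +i* tau) - Y (u +i* 0)) p q = 0.
    rewrite (@eq_segint _ _ (fun=> 0)); first by rewrite segint_cst ?mul0r// ltW.
    move=> u _; rewrite -(PY (u +i* 0)) (_ : u +i* 0 + _ = u +i* tau) ?subrr//.
    by apply: complex_eq; rewrite !complexReImE /= ?addr0 ?add0r.
  have cq := circ_segcont HX q0; have cp := circ_segcont HX (lt_trans pq q0).
  have cv := circ_segcont Hal v0.
  rewrite addr0 /X' /=.
  rewrite (@eq_segint _ _ (fun y => X (q +i* y) - X (p +i* y) - (q - p) * (al (v +i* y) + e))); last first.
    by move=> y _; ring.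
  have cc := @segcont_cst R e 0 tau.
  have cve := segcontD cv cc.
  rewrite segintB; last 2 first.
  - by apply: segcontD => //; exact: segcontN.
  - by apply: segcontM => //; exact: segcont_cst.
  rewrite segintB// segintZ// segintD// segint_cst ?subr0//; exact: ltW.
rewrite /Phi mul1r pqE mul1r add0r; apply.
- move=> x y t [tp s1 s2 s3 s4].
  have E1 : x + t * (q - p) = x + t / 2 * (q - p) + t / 2 * (q - p) by field.
  have E2 : y + t * tau = y + t / 2 * tau + t / 2 * tau by field.
  have u0 : 0 < t / 2 * (q - p) by rewrite mulr_gt0// divr_gt0.
  have w0 : 0 < t / 2 * tau by rewrite mulr_gt0// divr_gt0.
  rewrite {}E1 {}E2 in s2 s4 *.
  set u := t / 2 * (q - p) in u0 s2 *; set w := t / 2 * tau in w0 s4 *.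
  have h1 : annulus_area U x (x + u) y (y + w) + annulus_area U (x + u) (x + u + u) y (y + w) <=
      annulus_area U x (x + u + u) y (y + w) by apply: annulus_area_splitH; lra.
  have h2 : annulus_area U x (x + u) (y + w) (y + w + w) + annulus_area U (x + u) (x + u + u) (y + w) (y + w + w) <=
      annulus_area U x (x + u + u) (y + w) (y + w + w) by apply: annulus_area_splitH; lra.
  have h3 : annulus_area U x (x + u + u) y (y + w) + annulus_area U x (x + u + u) (y + w) (y + w + w) <=
      annulus_area U x (x + u + u) y (y + w + w) by apply: annulus_area_splitV; lra.
  lra.
move=> c hc e' e'0; have /andP[/andP[c1 c2] c3] := hc.
rewrite ?add0r in c3; rewrite ?pqE in c2; have c0 : Re c < 0 by exact: le_lt_trans q0.
have [r r0 Hr] := annulus_area_density oU c0 l0 t0 e'0.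
exists r => // x y t [tp s1 s2 s3 s4] tr hc'.
apply: le_trans (Hr _ _ _ tp tr hc').
rewrite lerD2r ler_wpM2r//; first by rewrite mulr_ge0// mulr_ge0// ltW.
apply: le_trans (pointwise c0).
have := Hd (Re c) (Im c); rewrite (_ : Re c +i* Im c = c); last by case: (c).
have -> : `|Re c - v| < d by rewrite ltr_norml; lra.
move=> /(_ isT c3); rewrite ltr_norml /XA' => /andP[_ h]; lra.
Qed.

(** A second bisection, now over radii, sums the thin rings. The circle means of [al] are never
    integrated: a majorant [w] with a known primitive [W] replaces them. *)
Lemma annulus_area_lower (W w : R -> R) (p q : R) : p < q -> q < 0 ->
  (forall v : R, p <= v <= q -> is_derive v 1 W (w v)) ->
  (forall v, p <= v <= q -> circ al v <= w v) ->
  circ X q - circ X p - (W q - W p) <= annulus_area U p q 0 tau.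
Proof.
move=> pq q0 HW Hw.
have pqE : p + (q - p) = q by rewrite addrC subrK.
have l0 : 0 < q - p by rewrite subr_gt0.
have t0 := @tau_gt0 R.
pose F x x' := annulus_area U x x' 0 tau - (circ X x' - circ X x - (W x' - W x)).
suff : 0 <= F p q by rewrite /F subr_ge0.
(* The second variable is a dummy of length 1. Each half interval occurs in two of the four quarters
   with weight t/2, so the factor [t] makes the superadditive [F] fit [bisection]. *)
pose S (x y t : R) := t * F x (x + t * (q - p)).
have -> : F p q = S p 0 1 by rewrite /S mul1r mul1r pqE.
apply: (@bisection _ S p 0 (q - p) 1) => //.
  move=> x y t [tp s1 s2 s3 s4]; rewrite /S.
  have -> : x + t * (q - p) = x + t / 2 * (q - p) + t / 2 * (q - p) by field.
  have u0 : 0 < t / 2 * (q - p) by rewrite mulr_gt0// divr_gt0.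
  set u := t / 2 * (q - p) in u0 *.
  have h : F x (x + u) + F (x + u) (x + u + u) <= F x (x + u + u).
    have : annulus_area U x (x + u) 0 tau + annulus_area U (x + u) (x + u + u) 0 tau <=
       annulus_area U x (x + u + u) 0 tau by apply: annulus_area_splitH; lra.
    by rewrite /F; lra.
  have := ler_wpM2l (ltW tp) h; rewrite mulrDr; lra.
move=> v cy hv _ e e0; rewrite pqE in hv.
have v0 : v < 0 by case/andP: hv => _ /le_lt_trans; exact.
(* Freezing and differentiating [W] each contribute e t / 2 to the error of [F], and the factor [t]
   in [S] yields [e * t ^+ 2]. *)
pose eta := e / (2 * (q - p) * tau); pose eps := e / (2 * (q - p)).
have eta0 : 0 < eta by rewrite /eta divr_gt0// !mulr_gt0.
have eps0 : 0 < eps by rewrite /eps divr_gt0// !mulr_gt0.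
have [r r0 Hr] := annulus_frozen v0 eta0.
have [s s0 Hs] := is_derive_eps (HW v hv) eps0.
exists (Num.min r s / (q - p)); first by rewrite divr_gt0// lt_min r0.
move=> x y t [tp s1 s2 s3 s4]; rewrite ltr_pdivlMr// lt_min => /andP[tr ts] hx _.
have u0 : 0 < t * (q - p) by rewrite mulr_gt0.
rewrite /S; set u := t * (q - p) in tr ts u0 s2 hx *.
rewrite pqE in s2.
have K1 : circ X (x + u) - circ X x - u * (circ al v + eta * tau) <= annulus_area U x (x + u) 0 tau.
  have E : x + u - x = u by ring.
  have := Hr x (x + u) hx; rewrite E; apply => //; first by rewrite ltrDl.
  exact: le_lt_trans q0.
case/andP: hx => x1 x2.
have K2 : `|W (x + u) - W v - w v * (x + u - v)| <= eps * (x + u - v).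
  have := Hs (x + u - v); rewrite (_ : v + (x + u - v) = x + u); last by ring.
  by rewrite ger0_norm ?subr_ge0//; apply; lra.
have K3 : `|W x - W v - w v * (x - v)| <= eps * (v - x).
  have := Hs (x - v); rewrite (_ : v + (x - v) = x); last by ring.
  by rewrite ler0_norm ?subr_le0// opprB; apply; lra.
have K4 : u * circ al v <= u * w v by rewrite ler_pM2l// Hw.
move: K2 K3; rewrite !ler_norml => /andP[K2 _] /andP[_ K3].
have K5 : - (u * (eta * tau) + eps * u) <= F x (x + u) by rewrite /F; lra.
have -> : - (e * t ^+ 2) = t * - (u * (eta * tau) + eps * u).
  have tn : tau != 0 by rewrite gt_eqF.
  have qn : q - p != 0 by rewrite gt_eqF.
  rewrite /u /eta /eps; move: tn qn; move: (pi *+ 2) => a; move: (q - p) => b an bn.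
  by field; rewrite an bn.
by rewrite ler_pM2l.
Qed.

End Ring.
End ConformalArea.

(** * Energy bound and overlap bound from the two choices of flux *)

Lemma is_derive_expR_sqr {R : realType} (k v : R) :
  is_derive v 1 (fun u => k / 2 * expR u ^+ 2) (k * expR v ^+ 2).
Proof.
have H := is_deriveZ (k / 2) (is_deriveX 2 (is_derive_expR v)).
by apply: (is_derive_eq H); rewrite /GRing.scale /= expr1; field.
Qed.

(** This explains the factor e^u in the penalty e^u |Q|^2 / (1 - e^u)^2: the exterior estimate needs
    only the smaller e^{2u}, but e^u gives this elementary primitive. *)
Lemma is_derive_onemexpR_inv {R : realType} (k v : R) : v < 0 ->
  is_derive v 1 (fun u => k * (1 - expR u)^-1) (k * (expR v * (1 - expR v)^-1 ^+ 2)).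
Proof.
move=> v0; have e1 : 1 - expR v != 0 by rewrite gt_eqF// subr_gt0 expR_lt1.
have H0 := is_deriveB (is_derive_cst (1 : R) v 1) (is_derive_expR v).
have H := is_deriveZ k (@realfun.is_deriveV R (fun u => 1 - expR u) v _ 1 e1 H0).
by apply: (is_derive_eq H); rewrite /GRing.scale /= sub0r; field.
Qed.

Section Deficit.
Context {R : realType}.
Local Notation C := R[i].
Local Notation tau := (pi *+ 2 : R).
Implicit Types (w c : C) (u v p q : R).
Variables (Q Q' : C -> C) (a x0 : C).
Hypothesis HQ : forall c, Re c < 0 -> cdiff Q c (Q' c).
Hypothesis PQ : tau_periodic Q.
Hypothesis Qlim : forall e : R, 0 < e -> exists u0 : R, forall w, Re w <= u0 -> cabs (Q w) <= e.
(** [A] stands for [annulus_area] over a full period, and [V] for the area of the overlap of the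
    domain with the unit disc about [x0]. The estimates below see the conformal map only through [Q]
    and these properties. *)
Variable A : set C -> R -> R -> R.
Hypothesis area_lower : forall (U : set C) (X XA XB Y YA YB al alA alB : C -> R),
  open_set U ->
  rdiff_on (fun c => Re c < 0) X XA XB -> rdiff_on (fun c => Re c < 0) Y YA YB ->
  rdiff_on (fun c => Re c < 0) al alA alB ->
  (forall w, Y (w + (0 +i* tau)) = Y w) ->
  (forall c, Re c < 0 -> XA c + YB c - al c <=
     (`[< U (x0 + cexp c * (a + Q c)) >]%:R + 1) *
     (expR (Re c) ^+ 2 * cabs (a + Q c + Q' c) ^+ 2)) ->
  forall (W w : R -> R) p q, p < q -> q < 0 ->
  (forall v : R, p <= v <= q -> is_derive v 1 W (w v)) ->
  (forall v, p <= v <= q -> circ al v <= w v) ->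
  circ X q - circ X p - (W q - W p) <= A U p q.
Variable V : R.
Hypothesis A_set0 : forall p q, p < q -> q < 0 -> A set0 p q <= pi.
Hypothesis A_disc : forall p q, p < q -> q < 0 ->
  A [set z | cabs (z - x0) < 1] p q <= V + pi.

Let N := circ (sqnorm Q).

Let sq w := expR (Re w) ^+ 2.

Let rdiff_expRe c : rdiff (fun w => expR (Re w)) c (expR (Re c)) 0.
Proof.
have := rdiff_comp_derive (is_derive_expR (Re c)) (rdiff_Re c).
by rewrite mulr1 mulr0.
Qed.

Let rdiff_sq c : rdiff sq c (2 * sq c) 0.
Proof.
have := rdiffM (rdiff_expRe c) (rdiff_expRe c).
rewrite !mul0r !mulr0 addr0 (_ : _ + _ = 2 * sq c); last by rewrite /sq; ring.
by apply: rdiff_ext => w; rewrite /sq expr2.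
Qed.

Lemma N_nondecreasing p q : p <= q -> q < 0 -> N p <= N q.
Proof.
have [u0 Hu0] := Qlim ltr01.
apply: (@circ_sqnorm_nondecreasing _ _ _ PQ HQ (1 * (tau - 0)) (Num.min u0 (-1))) => u.
rewrite le_min => /andP[u1 u2].
apply: le_trans (ler_norm _) _; apply: segint_bound; first exact/ltW/tau_gt0.
  by apply: sqnorm_segcont; [exact: HQ|lra].
move=> y _; rewrite sqnormE ger0_norm ?sqr_ge0// exprn_ile1 ?cabs_ge0//.
exact: Hu0.
Qed.

Lemma N_ge0 u : 0 <= N u.
Proof. exact: circ_sqnorm_ge0. Qed.

(** The constant value of the circle integrals is their limit at -oo, where [Q] tends to 0
    uniformly. *)
Lemma circ_holomorphic_eq0 (Z : C -> R) : (forall w, `|Z w| <= cabs (Q w)) ->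
  (forall p q, p < q -> q < 0 -> circ Z q = circ Z p) ->
  (forall u, u < 0 -> segcont (fun y => Z (u +i* y)) 0 tau) ->
  forall u, u < 0 -> circ Z u = 0.
Proof.
move=> ZQ Zc Zs u u0; apply/eqP; rewrite -normr_le0; apply/ler_addgt0Pl => e e0.
have t0 := @tau_gt0 R.
have [u1 Hu1] := Qlim (divr_gt0 e0 t0).
rewrite addr0 (Zc (Num.min u1 (u - 1)) u)//; last by rewrite gt_min; apply/orP; right; lra.
set v := Num.min _ _.
have vu1 : v <= u1 by rewrite ge_min lexx.
have v0 : v < 0 by rewrite gt_min; apply/orP; right; lra.
have : `|circ Z v| <= e / tau * (tau - 0).
  apply: segint_bound; [exact: ltW|exact: Zs|move=> y _].
  by apply: le_trans (ZQ _) _; exact: Hu1.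
by rewrite subr0 divfK// gt_eqF.
Qed.

Let aQ w := a^* * Q w.
Let aQ' w := a^* * Q' w.

Let HaQ c : Re c < 0 -> cdiff aQ c (aQ' c).
Proof.
move=> c0; have := cdiffM (cdiff_cst a^* c) (HQ c0).
by rewrite mul0r add0r.
Qed.

Lemma segcont_ReQ u : u < 0 -> segcont (fun y => Re (Q (u +i* y))) 0 tau.
Proof.
move=> u0; apply: (@rdiff_circ _ (fun w => Re (Q w))) => y; do 2 eexists.
exact: (cdiff_rdiff (HQ (u0 : Re (u +i* y) < 0))).1.
Qed.

Lemma segcont_ImQ u : u < 0 -> segcont (fun y => Im (Q (u +i* y))) 0 tau.
Proof.
move=> u0; apply: (@rdiff_circ _ (fun w => Im (Q w))) => y; do 2 eexists.
exact: (cdiff_rdiff (HQ (u0 : Re (u +i* y) < 0))).2.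
Qed.

Lemma circ_ReQ u : u < 0 -> circ (fun w => Re (Q w)) u = 0.
Proof.
apply: circ_holomorphic_eq0 => [w|p q pq q0|v v0]; first exact: Re_le_cabs.
  have l0 : 0 < q - p by rewrite subr_gt0.
  rewrite -{1}(subrK p q) addrC; apply: (circ_constant_Re l0 PQ) => c /andP[_ hc].
  by apply: HQ; lra.
exact: segcont_ReQ.
Qed.

Lemma circ_ImQ u : u < 0 -> circ (fun w => Im (Q w)) u = 0.
Proof.
apply: circ_holomorphic_eq0 => [w|p q pq q0|v v0]; first exact: Im_le_cabs.
  have l0 : 0 < q - p by rewrite subr_gt0.
  rewrite -{1}(subrK p q) addrC; apply: (circ_constant_Im l0 PQ) => c /andP[_ hc].
  by apply: HQ; lra.
exact: segcont_ImQ.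
Qed.

Let a2 := cabs a ^+ 2.

(** The field ([X1], [Y1]) has divergence e^{2u} (|a|^2 + 2 Re conj(a) (Q + Q')): by Cauchy-Riemann
    [Y1] supplies the second half of the Q' term. Since [Q] has mean 0, only the constant part of
    [X1] contributes to [circ_X1]. *)
Let X1 w := sq w * (a2 / 2 + Re (aQ w)).
Let Y1 w := sq w * Im (aQ w).
Let XA1 c := 2 * sq c * (a2 / 2 + Re (aQ c)) + sq c * (0 + Re (aQ' c)).
Let XB1 c := 0 * (a2 / 2 + Re (aQ c)) + sq c * (0 + - Im (aQ' c)).
Let YA1 c := 2 * sq c * Im (aQ c) + sq c * Im (aQ' c).
Let YB1 c := 0 * Im (aQ c) + sq c * Re (aQ' c).

Let HX1 : rdiff_on (fun c => Re c < 0) X1 XA1 XB1.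
Proof.
move=> c c0; apply: rdiffM; first exact: rdiff_sq.
by apply: rdiffD; [exact: rdiff_cst|exact: (cdiff_rdiff (HaQ c0)).1].
Qed.

Let HY1 : rdiff_on (fun c => Re c < 0) Y1 YA1 YB1.
Proof.
move=> c c0; apply: rdiffM; first exact: rdiff_sq.
exact: (cdiff_rdiff (HaQ c0)).2.
Qed.

Let PY1 w : Y1 (w + (0 +i* tau)) = Y1 w.
Proof. by rewrite /Y1 /sq /aQ PQ [Re (w + _)]complexReImE /= addr0. Qed.

Let circ_X1 u : u < 0 -> circ X1 u = pi * a2 * expR u ^+ 2.
Proof.
move=> u0.
have E y : X1 (u +i* y) = expR u ^+ 2 * (a2 / 2 + (Re a * Re (Q (u +i* y)) + Im a * Im (Q (u +i* y)))).
  by rewrite /X1 /sq /aQ !complexReImE /=; ring.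
rewrite /circ (eq_segint (fun y _ => E y)).
have c1 := segcont_ReQ u0; have c2 := segcont_ImQ u0.
have k (r : R) := @segcont_cst R r 0 tau.
have c3 := segcontM (k (Re a)) c1; have c4 := segcontM (k (Im a)) c2.
have c5 := segcontD c3 c4.
have c6 := k (a2 / 2); have c7 := segcontD c6 c5.
rewrite segintZ// segintD//.
rewrite segintD// !segintZ//.
rewrite -/(circ (fun w => Re (Q w)) u) -/(circ (fun w => Im (Q w)) u) circ_ReQ// circ_ImQ//.
rewrite segint_cst; last exact/ltW/tau_gt0.
by rewrite !mulr0 !addr0 subr0 -mulr_natr; field.
Qed.

Let circ_sqN u : u < 0 -> circ (fun w => sq w * sqnorm Q w) u = expR u ^+ 2 * N u.
Proof.
move=> u0; rewrite -segintZ; last by apply: sqnorm_segcont u0; exact: HQ.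
exact: eq_segint.
Qed.

Let rdiff_N c : Re c < 0 ->
  rdiff (sqnorm Q) c (2 * Re ((Q c)^* * Q' c)) (2 * Im (Q c * (Q' c)^*)).
Proof. by move=> /HQ /rdiff_sqnorm. Qed.

(** Adding e^{2u} |Q|^2 to the flux gains N(q) e^{2q} on the outer circle, while the compensating
    [al] costs only half of N(q) (e^{2q} - e^{2p}), because N is nondecreasing and e^{2u} has
    primitive e^{2u} / 2. *)
Lemma energy_lower p q : p < q -> q < 0 ->
  (pi * a2 + N q / 2) * (expR q ^+ 2 - expR p ^+ 2) <= pi.
Proof.
move=> pq q0; apply: le_trans (A_set0 pq q0).
pose al w := sq w * sqnorm Q w.
pose alA c := 2 * sq c * sqnorm Q c + sq c * (2 * Re ((Q c)^* * Q' c)).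
pose alB c := 0 * sqnorm Q c + sq c * (2 * Im (Q c * (Q' c)^*)).
have Hal : rdiff_on (fun c => Re c < 0) al alA alB.
  by move=> c c0; apply: rdiffM; [exact: rdiff_sq|exact: rdiff_N].
pose X w := X1 w + al w.
have HX : rdiff_on (fun c => Re c < 0) X (fun c => XA1 c + alA c) (fun c => XB1 c + alB c).
  by move=> c c0; apply: rdiffD; [exact: HX1|exact: Hal].
pose W u := N q / 2 * expR u ^+ 2; pose w u := N q * expR u ^+ 2.
have HW v : p <= v <= q -> is_derive v 1 W (w v).
  by move=> _; exact: is_derive_expR_sqr.
have Hw v : p <= v <= q -> circ al v <= w v.
  move=> /andP[pv vq]; have v0 := le_lt_trans vq q0.
  rewrite circ_sqN// /w mulrC ler_wpM2r ?sqr_ge0//.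
  exact: N_nondecreasing.
have := area_lower (U := set0) _ HX HY1 Hal PY1 _ pq q0 HW Hw.
have cX u : u < 0 -> circ X u = pi * a2 * expR u ^+ 2 + expR u ^+ 2 * N u.
  move=> u0; rewrite -circ_X1// -circ_sqN//; apply: segintD.
    by apply: rdiff_circ => y; do 2 eexists; exact: (@HX1 (u +i* y) u0).
  by apply: rdiff_circ => y; do 2 eexists; exact: (@Hal (u +i* y) u0).
rewrite !cX//; last exact: lt_trans q0.
move=> H; apply: le_trans (H _ _).
- have : N p <= N q by apply: N_nondecreasing => //; exact: ltW.
  rewrite /W.
  by move=> /(ler_wpM2l (sqr_ge0 (expR p))); lra.
- by move=> z.
move=> c c0; rewrite /alA /al /XA1 /YB1 /aQ /aQ' /sqnorm.
set s := sq c; have s0 : 0 <= s by exact: sqr_ge0.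
(* The two sides of the pointwise inequality differ by exactly e^{2u} |Q'|^2. *)
have : 0 <= s * (Re (Q' c) ^+ 2 + Im (Q' c) ^+ 2) by rewrite mulr_ge0// addr_ge0// sqr_ge0.
have -> : (`[< (@set0 C) (x0 + cexp c * (a + Q c)) >]%:R : R) = 0 by rewrite asboolF.
rewrite [0 + 1]add0r mul1r -/(sq c) -/s cabs_sqr !complexReImE /a2 cabs_sqr.
lra.
Qed.

Lemma expR_near0 (e : R) : 0 < e -> e < 1 -> exists2 p : R, p < 0 & expR p = e.
Proof.
move=> e0 e1; exists (ln e); first by apply: ln_lt0; rewrite e0.
exact: lnK.
Qed.

(** The limit of [energy_lower] as e^q tends to 1 and e^p to 0, with N(u) <= N(q). *)
Lemma energy_bound u : u < 0 -> pi * a2 + N u / 2 <= pi.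
Proof.
move=> u0; set B := _ + _; rewrite leNgt; apply/negP => HB.
have B0 : 0 < B by apply: lt_trans HB; exact: pi_gt0.
(* Then [B * (1 - 2 * e)] is the midpoint of [B] and pi, still above pi. *)
pose e := (B - pi) / (4 * B).
have e0 : 0 < e by rewrite /e divr_gt0 ?subr_gt0// mulr_gt0.
have e4 : e <= 1 / 4.
  rewrite /e ler_pdivrMr ?mulr_gt0//; have := pi_ge0 R; lra.
have [||q1 q10 eq1] := @expR_near0 (1 - e); [lra|lra|].
have [||p1 p10 ep1] := @expR_near0 e; [lra|lra|].
pose q := Num.max u q1; pose p := Num.min p1 (q - 1).
have q0 : q < 0 by rewrite gt_max u0.
have pq : p < q by rewrite gt_min; apply/orP; right; lra.
have Eq : 1 - e <= expR q by rewrite -eq1 ler_expR le_max lexx orbT.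
have Ep : expR p <= e by rewrite -ep1 ler_expR ge_min lexx.
have Nq : N u <= N q by apply: N_nondecreasing => //; rewrite le_max lexx.
have := energy_lower pq q0.
have S1 : (1 - e) ^+ 2 <= expR q ^+ 2 by rewrite ler_pXn2r// nnegrE ?expR_ge0//; lra.
have S2 : expR p ^+ 2 <= e ^+ 2 by rewrite ler_pXn2r// nnegrE ?expR_ge0//; lra.
have S3 : 1 - 2 * e <= expR q ^+ 2 - expR p ^+ 2 by move: S1 S2; rewrite sqrrB; lra.
have : B * (1 - 2 * e) <= (pi * a2 + N q / 2) * (expR q ^+ 2 - expR p ^+ 2).
  by apply: ler_pM; [exact: ltW|lra|rewrite /B; lra|].
have -> : B * (1 - 2 * e) = (B + pi) / 2.
  by rewrite /e; field; rewrite gt_eqF.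
lra.
Qed.

Lemma derivative_sqr_le1 : a2 <= 1.
Proof.
have m1 : (-1 : R) < 0 by lra.
have := energy_bound m1; have := N_ge0 (-1); have := @pi_gt0 R => p0 n0 h.
have : pi * a2 <= pi * 1 by lra.
by rewrite ler_pM2l.
Qed.

Let oU : open_set [set z : C | cabs (z - x0) < 1].
Proof.
move=> z /= hz; exists (1 - cabs (z - x0)); first by rewrite subr_gt0.
move=> h hh; rewrite (_ : z + h - x0 = (z - x0) + h); last by ring.
by rewrite (le_lt_trans (cabsD _ _))//; lra.
Qed.

(** Out of 2 pi, the outer radius 1 - t loses at most 4 pi t, the inner circle 2 pi t and the
    weighted energy 4 pi t. This is 10 pi t, within the stated 12 pi t. *)
Lemma disc_area_lower (t : R) : 0 < t -> t < 1 -> 1 - a2 <= t ^+ 2 ->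
  pi - 12 * pi * t <= V.
Proof.
move=> t0 t1 at2.
have p0 := @pi_gt0 R.
have [||q q0 eq] := @expR_near0 (1 - t); [lra|lra|].
have [p1 p10 ep1] := @expR_near0 t t0 t1.
pose p := Num.min p1 (q - 1).
have pq : p < q by rewrite gt_min; apply/orP; right; lra.
have Ep : expR p <= t by rewrite -ep1 ler_expR ge_min lexx.
pose v w := (1 - expR (Re w))^-1.
pose al w := 2 * (expR (Re w) * (v w * v w)) * sqnorm Q w.
have rv c : Re c < 0 -> rdiff v c (1 * (expR (Re c) * (1 - expR (Re c))^-1 ^+ 2) * 1)
    (1 * (expR (Re c) * (1 - expR (Re c))^-1 ^+ 2) * 0).
  move=> c0; have H := is_derive_onemexpR_inv 1 c0.
  by apply: rdiff_ext (rdiff_comp_derive H (rdiff_Re c)) => w; rewrite mul1r.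
have Hal0 c : Re c < 0 -> rdiffable al c.
  move=> c0; do 2 eexists; apply: rdiffM; last exact: rdiff_N.
  apply: rdiffZ; apply: rdiffM; first exact: rdiff_expRe.
  by apply: rdiffM; exact: rv.
(* The values of the partial derivatives of [al] do not enter the estimate, so they are chosen
   rather than computed, with 0 as default outside the half-plane. *)
have /choice[alA HalA] : forall c, exists x, Re c < 0 -> exists B, rdiff al c x B.
  move=> c; have [c0|c0] := ltP (Re c) 0; last by exists 0 => h; exfalso; lra.
  by have [x [y h]] := Hal0 c c0; exists x => _; exists y.
have /choice[alB HalB] : forall c, exists x, Re c < 0 -> rdiff al c (alA c) x.
  move=> c; have [c0|c0] := ltP (Re c) 0; last by exists 0 => h; exfalso; lra.
  by have [y h] := HalA c c0; exists y.
have Hal : rdiff_on (fun c => Re c < 0) al alA alB by move=> c; exact: HalB.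
pose X w := 2 * X1 w; pose Y w := 2 * Y1 w.
have HX : rdiff_on (fun c => Re c < 0) X (fun c => 2 * XA1 c) (fun c => 2 * XB1 c).
  by move=> c c0; apply: rdiffZ; exact: HX1.
have HY : rdiff_on (fun c => Re c < 0) Y (fun c => 2 * YA1 c) (fun c => 2 * YB1 c).
  by move=> c c0; apply: rdiffZ; exact: HY1.
have PY w : Y (w + (0 +i* tau)) = Y w by rewrite /Y PY1.
pose kap := 2 * pi * (1 - a2).
have kap0 : 0 <= kap.
  by rewrite /kap mulr_ge0//; [lra|have := derivative_sqr_le1; lra].
have Nk u : u < 0 -> N u <= kap by move=> /energy_bound; rewrite /kap; lra.
pose W u := 2 * kap * (1 - expR u)^-1.
pose w u := 2 * kap * (expR u * (1 - expR u)^-1 ^+ 2).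
have HW x : p <= x <= q -> is_derive x 1 W (w x).
  by move=> /andP[_ xq]; apply: is_derive_onemexpR_inv; lra.
have Hw x : p <= x <= q -> circ al x <= w x.
  move=> /andP[_ xq]; have x00 : x < 0 by lra.
  have -> : circ al x = 2 * (expR x * (1 - expR x)^-1 ^+ 2) * N x.
    rewrite /N /circ -segintZ; last by apply: sqnorm_segcont x00; exact: HQ.
    by apply: eq_segint => y _; rewrite /al /v /= expr2.
  rewrite /w [2 * kap * _]mulrAC ler_wpM2l ?Nk// mulr_ge0// mulr_ge0 ?expR_ge0// sqr_ge0//.
have cX u : u < 0 -> circ X u = 2 * (pi * a2 * expR u ^+ 2).
  move=> u0; rewrite -circ_X1// /circ segintZ//.
  by apply: (@rdiff_circ _ X1) => y; do 2 eexists; exact: (@HX1 (u +i* y) u0).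
have a1 := derivative_sqr_le1.
have := area_lower oU HX HY Hal PY _ pq q0 HW Hw.
rewrite !cX//; last exact: lt_trans q0.
have := A_disc pq q0; set Ad := A _ _ _ => HAd H.
have {H}H := H _.
have {}H := le_trans (H _) HAd.
suff H2 : forall c : C, Re c < 0 -> 2 * XA1 c + 2 * YB1 c - al c <=
     (`[< [set z : C | cabs (z - x0) < 1] (x0 + cexp c * (a + Q c)) >]%:R + 1) *
     (expR (Re c) ^+ 2 * cabs (a + Q c + Q' c) ^+ 2).
  have {H}:= H H2; rewrite /W eq.
  have -> : (1 - (1 - t))^-1 = t^-1 by congr _^-1; ring.
  have P1 : 0 <= kap * (1 - expR p)^-1.
    by rewrite mulr_ge0// invr_ge0 subr_ge0 expR_le1 ltW// (lt_trans pq).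
  have P2 : kap * t^-1 <= 2 * pi * t.
    rewrite ler_pdivrMr// /kap.
    have := ler_wpM2l (ltW p0) at2; lra.
  have a0 : 0 <= a2 by exact: sqr_ge0.
  have P3 : a2 * expR p ^+ 2 <= t.
    have : expR p ^+ 2 <= t ^+ 2 by rewrite ler_pXn2r// nnegrE ?expR_ge0// ltW.
    have : t ^+ 2 <= t by rewrite expr2 ler_piMr// ltW.
    move=> h1 h2; apply: le_trans (ler_piMl _ a1) _; first exact: sqr_ge0.
    exact: le_trans h1.
  have P4 : 1 - 2 * t <= a2 * (1 - t) ^+ 2.
    have h : (1 - t ^+ 2) * (1 - t) ^+ 2 <= a2 * (1 - t) ^+ 2.
      by rewrite ler_wpM2r ?sqr_ge0//; lra.
    apply: le_trans h.
    have h1 : 0 <= t ^+ 3 * (2 - t) by rewrite mulr_ge0 ?exprn_ge0//; lra.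
    have -> : (1 - t ^+ 2) * (1 - t) ^+ 2 = 1 - 2 * t + t ^+ 3 * (2 - t) by ring.
    lra.
  have P5 := ler_wpM2l (ltW p0) P3; have P6 := ler_wpM2l (ltW p0) P4.
  have P7 : 0 < pi * t by rewrite mulr_gt0.
  lra.
move=> c c0; rewrite /XA1 /YB1 /aQ /aQ'.
set s := sq c; have s0 : 0 <= s by exact: sqr_ge0.
have ee : 0 < expR (Re c) by exact: expR_gt0.
have e1 : expR (Re c) < 1 by rewrite expR_lt1.
have vp : 0 < v c by rewrite invr_gt0 subr_gt0.
have qn0 : 0 <= sqnorm Q c by rewrite sqnormE sqr_ge0.
have al0 : 0 <= al c by rewrite /al mulr_ge0// mulr_ge0// mulr_ge0 ?expR_ge0// mulr_ge0// ltW.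
rewrite -/(sq c) -/s cabs_sqr !complexReImE.
set r1 := Re (Q' c); set r2 := Im (Q' c); set b1 := Re (Q c); set b2 := Im (Q c).
case: asboolP => /= [_|].
  have : 0 <= s * ((b1 + r1) ^+ 2 + (b2 + r2) ^+ 2) by rewrite mulr_ge0// addr_ge0// sqr_ge0.
  rewrite /a2 cabs_sqr; lra.
rewrite (_ : x0 + _ - x0 = cexp c * (a + Q c)); last by ring.
rewrite cabsM cabs_cexp => /negP; rewrite -leNgt => Hout.
(* Outside the disc e^u (|a| + |Q|) >= 1 with |a| <= 1, whence e^u |Q| >= 1 - e^u; the square of the
   quotient is at least 1, hence at least e^{2u} |a|^2. *)
have al2 : 2 * (s * a2) <= al c.
  have ca : cabs a <= 1.
    by rewrite -(ler_pXn2r (n := 2))// ?nnegrE ?cabs_ge0// expr1n.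
  have h1 : 1 - expR (Re c) <= expR (Re c) * cabs (Q c).
    have h2 := ler_wpM2l (ltW ee) (cabsD a (Q c)).
    have h3 := ler_wpM2l (ltW ee) ca.
    lra.
  have h2 : 1 <= v c * (expR (Re c) * cabs (Q c)).
    by rewrite /v mulrC ler_pdivlMr ?mul1r// subr_gt0.
  have h3 : 1 <= (v c * (expR (Re c) * cabs (Q c))) ^+ 2 by rewrite exprn_ege1.
  have h4 : al c * expR (Re c) = 2 * (v c * (expR (Re c) * cabs (Q c))) ^+ 2.
    by rewrite /al sqnormE; ring.
  have h5 : al c * expR (Re c) <= al c by rewrite ler_piMr// ltW.
  have h6 : s * a2 <= 1.
    rewrite mulr_ile1 ?sqr_ge0//.
    by rewrite /s /sq exprn_ile1// ?expR_ge0// ltW.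
  lra.
(* With p = Q + Q', |a + p|^2 = |p - a|^2 + 4 Re (conj(a) p): a single copy of the area carries the
   full linear term, and [al2] covers the missing 2 e^{2u} |a|^2. *)
have : 0 <= s * ((b1 + r1 - Re a) ^+ 2 + (b2 + r2 - Im a) ^+ 2) by rewrite mulr_ge0// addr_ge0// sqr_ge0.
move: al2; rewrite /a2 cabs_sqr; lra.
Qed.

End Deficit.

(** * Overlap of the domain with the unit disc about x0 *)

Section Uniformization.
Context {R : realType}.
Local Notation mu2 := ((@lebesgue_measure R) \x (@lebesgue_measure R))%E.
Local Notation T := (measurableTypeR R).
Local Notation C := R[i].
Local Notation tau := (pi *+ 2 : R).

(** Two sets of equal measure have differences of equal measure, whence the factor 2. *)
Lemma plane_area_setY (M D : set (T * T)) (r : R) : measurable M -> measurable D ->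
  mu2 M = r%:E -> mu2 D = r%:E ->
  fine (mu2 (M `+` D)) = 2 * (r - plane_area (M `&` D)).
Proof.
move=> mM mD muM muD.
have mI : measurable (M `&` D) by exact: measurableI.
have finM : (mu2 M < +oo)%E by rewrite muM ltry.
have finD : (mu2 D < +oo)%E by rewrite muD ltry.
have VE : mu2 (M `&` D) = (plane_area (M `&` D))%:E.
  rewrite /plane_area fineK// ge0_fin_numE//.
  by apply: le_lt_trans finM; apply: le_measure => //; rewrite inE.
have e1 : mu2 (M `\` D) = (r - plane_area (M `&` D))%:E.
  transitivity (mu2 M - mu2 (M `&` D))%E; last by rewrite muM VE EFinB.
  by apply: measureD.
have e2 : mu2 (D `\` M) = (r - plane_area (M `&` D))%:E.
  transitivity (mu2 D - mu2 (D `&` M))%E; last by rewrite muD setIC VE EFinB.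
  by apply: measureD.
rewrite /setY measureU//.
- by rewrite [X in (X + _)%E]e1 [X in (_ + X)%E]e2 /=; ring.
- exact: measurableD.
- exact: measurableD.
by apply/seteqP; split => // p [[_ h] [h' _]].
Qed.

Lemma discE (c w : C) (r : R) : disc c r w <-> cabs (w - c) < r.
Proof. by rewrite /disc /ball /= normE ltcR cabsB. Qed.

Lemma open_planeE (A : set (plane R)) : open A -> forall x, A x ->
  exists2 r : R, 0 < r & forall h : C, cabs h < r -> A (x + h).
Proof.
rewrite openE => oA x /oA; rewrite /interior => /nbhs_ballP[e /=].
rewrite ltcE /= => /andP[/eqP ei e0] He.
have eE : e = (Re e)%:C by apply: complex_eq => //=.
exists (Re e) => // h hr; apply: He; rewrite eE.
by apply/discE; rewrite addrAC subrr add0r.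
Qed.

Lemma open_area_measurable (A : set (plane R)) : open A ->
  measurable [set p : T * T | A (ofpair p)].
Proof.
move=> oA; apply: open_plane_measurable => p Ap.
have [r r0 Hr] := open_planeE oA Ap.
exists (r / 2); first by rewrite divr_gt0.
move=> q h1 h2; rewrite /mkset (_ : ofpair q = ofpair p + (ofpair q - ofpair p)); last by ring.
apply: Hr; rewrite (le_lt_trans (cabs_le _))// !complexReImE /=; lra.
Qed.

Variables (g f : C -> C) (g' : C -> C) (Om : set C) (a x0 : C).
Hypothesis Hg : forall z, cabs z < 1 -> cdiff g z (g' z).
Hypothesis Hf : forall x, Om x -> exists d, cdiff f x d.
Hypothesis gOm : forall z, cabs z < 1 -> Om (g z).
Hypothesis fD : forall x, Om x -> cabs (f x) < 1.
Hypothesis gK : forall z, cabs z < 1 -> f (g z) = z.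
Hypothesis fK : forall x, Om x -> g (f x) = x.
Hypothesis Om_open : forall x, Om x ->
  exists2 r : R, 0 < r & forall h, cabs h < r -> Om (x + h).
Hypothesis g0 : g 0 = x0.
Hypothesis ga : g' 0 = a.
Let M : set (T * T) := [set p | Om (ofpair p)].
Hypothesis mM : measurable M.
Hypothesis muM : mu2 M = (pi : R)%:E.
Let D : set (T * T) := [set p | cabs (ofpair p - x0) < 1].

Lemma disc_overlap : cabs a ^+ 2 <= 1 /\
  forall t : R, 0 < t -> t < 1 -> 1 - cabs a ^+ 2 <= t ^+ 2 ->
    pi - 12 * pi * t <= plane_area (M `&` D).
Proof.
have mD : measurable D by exact: open_disc_measurable.
have finM : (mu2 M < +oo)%E by rewrite muM ltry.
have finMD : (mu2 (M `&` D) < +oo)%E.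
  apply: le_lt_trans finM; apply: le_measure => //; rewrite inE//.
  exact: measurableI.
have ga0 : cdiff g 0 a by rewrite -ga; apply: Hg; rewrite cabs0.
(* The relative remainder (g(z) - x0) / z - a at z = e^w: it tends to 0 at -oo because g'(0) = a.
   The product rule then dictates [Q']. *)
pose Q (w : C) := (logcoord g w + - x0) * cexp (- w) + - a.
pose Q' (c : C) := dlogcoord g' c * cexp (- c) - (a + Q c).
have ce (w : C) : cexp (- w) * cexp w = 1 by rewrite cexpN mulVf// cexp_neq0.
have GE (w : C) : x0 + cexp w * (a + Q w) = logcoord g w.
  rewrite (_ : x0 + _ = x0 + (logcoord g w - x0) * (cexp (- w) * cexp w)).
    by rewrite ce mulr1 addrC subrK.
  by rewrite /Q; ring.
have dGE (c : C) : cexp c * (a + Q c + Q' c) = dlogcoord g' c.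
  rewrite (_ : _ * _ = dlogcoord g' c * (cexp (- c) * cexp c)); first by rewrite ce mulr1.
  by rewrite /Q'; ring.
have HQ (c : C) : Re c < 0 -> cdiff Q c (Q' c).
  move=> c0.
  have HN : cdiff (fun w : C => cexp (- w)) c (cexp (- c) * -1).
    apply: (@cdiff_comp _ cexp (fun w => - w)); first exact: cdiff_cexp.
    have := cdiffM (cdiff_cst (-1) c) (cdiff_id c); rewrite mul0r add0r mulr1.
    by apply: cdiff_ext => w; rewrite mulN1r.
  have H1 := cdiffD (cdiff_logcoord Hg c0) (cdiff_cst (- x0) c).
  have := cdiffD (cdiffM H1 HN) (cdiff_cst (- a) c).
  rewrite (_ : _ + 0 = Q' c)//; rewrite /Q' /Q; ring.
have PQ : tau_periodic Q.
  move=> w; rewrite /Q /logcoord cexp_period; congr (_ * _ + _).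
  by rewrite !cexpN cexp_period.
have Qlim (e : R) : 0 < e -> exists u0 : R, forall w, Re w <= u0 -> cabs (Q w) <= e.
  move=> /ga0[r r0 Hr].
  exists (ln (r / 2)) => w hw.
  have zr : cabs (cexp w) < r.
    rewrite cabs_cexp; apply: le_lt_trans (_ : expR (ln (r / 2)) < r).
      by rewrite ler_expR.
    by rewrite lnK ?posrE ?divr_gt0// ltr_pdivrMr// ltr_pMr// ltr1n.
  have := Hr _ zr; rewrite add0r g0.
  have -> : Q w = (g (cexp w) - x0 - a * cexp w) * cexp (- w).
    rewrite mulrBl -[a * _ * _]mulrA [cexp w * _]mulrC ce mulr1.
    by rewrite /Q /logcoord.
  rewrite cabsM cexpN cabsV => H.
  by rewrite ler_pdivrMr// cabs_gt0 cexp_neq0.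
pose A U p q := annulus_area g U p q 0 tau.
have lower (U : set C) (X XA XB Y YA YB al alA alB : C -> R) : open_set U ->
    rdiff_on (fun c => Re c < 0) X XA XB -> rdiff_on (fun c => Re c < 0) Y YA YB ->
    rdiff_on (fun c => Re c < 0) al alA alB ->
    (forall w, Y (w + (0 +i* tau)) = Y w) ->
    (forall c, Re c < 0 -> XA c + YB c - al c <=
       (`[< U (x0 + cexp c * (a + Q c)) >]%:R + 1) *
       (expR (Re c) ^+ 2 * cabs (a + Q c + Q' c) ^+ 2)) ->
    forall (W w : R -> R) p q, p < q -> q < 0 ->
    (forall v : R, p <= v <= q -> is_derive v 1 W (w v)) ->
    (forall v, p <= v <= q -> circ al v <= w v) ->
    circ X q - circ X p - (W q - W p) <= A U p q.
  move=> oU HX HY Hal PY pw W w p q pq q0 HW Hw.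
  apply: (annulus_area_lower Hg Hf gOm fD gK fK Om_open mM finM oU HX HY Hal PY _ pq q0 HW Hw).
  move=> c c0; have := pw c c0; rewrite GE -dGE cabsM exprMn cabs_cexp.
  exact.
have image_le p q : inner_area (rect_image g setT p q 0 tau) <= pi.
  have -> : pi = plane_area M :> R by rewrite /plane_area muM.
  by apply: (inner_area_le mM finM); exact: rect_image_within.
(* With [set0] only the unweighted copy of the image counts, and it lies in the domain, of area
   pi. *)
have A_set0 p q : p < q -> q < 0 -> A set0 p q <= pi.
  move=> _ _; rewrite /A /annulus_area -[leRHS]add0r lerD//.
  have -> : 0 = plane_area (set0 : set (T * T)) by rewrite /plane_area measure0.
  apply: inner_area_le => //; first by rewrite measure0 ltry.
  by move=> x [].
split; first exact: (derivative_sqr_le1 HQ PQ Qlim lower A_set0).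
apply: (disc_area_lower HQ PQ Qlim lower A_set0) => p q _ _.
rewrite /A /annulus_area lerD//.
apply: inner_area_le => //; first exact: measurableI.
move=> x hx; split; last by case: hx.
exact: (rect_image_within gOm hx).
Qed.

End Uniformization.

(** * From the overlap with one disc to the Fraenkel asymmetry *)

Theorem corollary3p6 (R : realType) :
  exists C : R, 4 < C /\
    forall Omega : set (plane R),
      open Omega -> bounded_set Omega -> simply_connected Omega ->
      area Omega = (pi%:E)%E ->
    forall (x0 : plane R) (f finv : plane R -> plane R),
      Omega x0 -> holomorphic_iso Omega (disc 0 1) f finv -> f x0 = 0 ->
      1 / `|(f^`())%classic x0| = `|(finv^`())%classic 0| /\
      `|(finv^`())%classic 0| <=
        (Num.sqrt (1 - 1 / C * fraenkel_asymmetry Omega ^+ 2))%:C.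
Proof.
(* 576 is the square of 24: the disc about [x0] has symmetric difference 2 (pi - V) <= 24 pi t, so
   the asymmetry is at most 24 t. *)
exists 576; split; first by rewrite ltr_nat.
move=> Om oOm _ _ areaOm x0 f g Ox0 [fO gO [fgK gfK] hf hg] fx0.
have d01 z : disc 0 1 z <-> cabs z < 1 by rewrite discE subr0.
have Hg z : cabs z < 1 -> cdiff g z (g^`()%classic z).
  by move=> /d01 z1; apply: derivable_cdiff; exact: hg.
have Hf x : Om x -> cdiff f x (f^`()%classic x).
  by move=> Ox; apply: derivable_cdiff; exact: hf.
have gOm z : cabs z < 1 -> Om (g z) by move=> /d01 /gO.
have fD x : Om x -> cabs (f x) < 1 by move=> /fO /d01.
have gK z : cabs z < 1 -> f (g z) = z by move=> /d01 z1; apply: gfK; rewrite inE.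
have fK x : Om x -> g (f x) = x by move=> Ox; apply: fgK; rewrite inE.
have g0 : g 0 = x0 by rewrite -fx0 fK.
have z1 : cabs (0 : R[i]) < 1 by rewrite cabs0.
set a := g^`()%classic 0; set d := f^`()%classic x0.
have Hd : cdiff f (g 0) d by rewrite g0; exact: Hf.
have da : d * a = 1 by exact: (derivative_inverse Hg gK z1 Hd).
split.
  have d0 : d != 0 by apply: contra_eq_neq da => ->; rewrite mul0r eq_sym oner_eq0.
  by rewrite div1r -normfV; congr `|_|; apply: (mulfI d0); rewrite mulfV// da.
rewrite normE lecR.
pose M : set (measurableTypeR R * measurableTypeR R) := [set p | Om (ofpair p)].
pose D : set (measurableTypeR R * measurableTypeR R) := [set p | cabs (ofpair p - x0) < 1].
have mM : measurable M by exact: open_area_measurable.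
have mD : measurable D by exact: open_disc_measurable.
have muM : (@lebesgue_measure R \x @lebesgue_measure R)%E M = (pi : R)%:E by exact: areaOm.
have muD : (@lebesgue_measure R \x @lebesgue_measure R)%E D = (pi : R)%:E.
  by rewrite /D area_disc// expr1n mulr1.
have Om_op := open_planeE oOm.
have Hf' (x : R[i]) : Om x -> exists d : R[i], cdiff f x d by move=> /Hf; eexists; eassumption.
pose V := plane_area (M `&` D).
have [eta0 overlap] := disc_overlap Hg Hf' gOm fD gK fK Om_op g0 erefl mM muM.
have p0 := @pi_gt0 R.
have symE : fine (area (Om `+` disc x0 1)) = 2 * (pi - V).
  rewrite -(plane_area_setY mM mD muM muD) /area; congr (fine (_ _)).
  apply/funext => p; apply/propext.
  rewrite /setY /=; split => -[[h1 h2]|[h1 h2]].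
  - by left; split => // /discE.
  - by right; split => //; apply/discE.
  - by left; split => // /discE.
  - by right; split => //; apply/discE.
pose S := [set m : R | exists c : plane R, exists r : R,
    [/\ 0 < r, area (disc c r) = area Om &
        m = fine (area (Om `+` disc c r)) / fine (area Om)]].
have S_ge0 m : S m -> 0 <= m.
  by move=> [c [r [_ _ ->]]]; rewrite divr_ge0// fine_ge0// measure_ge0.
have Sm : S (2 * (pi - V) / pi).
  exists x0, 1; split => //; last by rewrite symE areaOm.
  rewrite areaOm -muD /area; congr (_ _); apply/funext => p; apply/propext.
  by split => /discE.
have A0 : 0 <= fraenkel_asymmetry Om.
  by apply: lb_le_inf => [|m]; [exists (2 * (pi - V) / pi)|exact: S_ge0].
have AV : fraenkel_asymmetry Om <= 2 * (pi - V) / pi.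
  by apply: ge_inf => //; exists 0 => m; exact: S_ge0.
set A := fraenkel_asymmetry Om in A0 AV *.
pose eta2 := 1 - cabs a ^+ 2.
have At (t : R) : 0 < t -> t < 1 -> eta2 <= t ^+ 2 -> A <= 24 * t.
  move=> t0 t1 h; apply: le_trans AV _; rewrite ler_pdivrMr//.
  have h2 : pi - 12 * pi * t <= V by exact: overlap.
  lra.
have {}eta0 : 0 <= eta2 by rewrite subr_ge0.
have an0 : 0 < cabs a.
  rewrite cabs_gt0; apply: contra_eq_neq da => ->.
  by rewrite mulr0 eq_sym oner_eq0.
have A2 : A ^+ 2 <= 576 * eta2.
  (* The overlap bound requires t > 0. If [eta2] is 0, every small t is admissible and the asymmetry
     vanishes; otherwise t is the root of [eta2]. *)
  have [e0|e0] := eqVneq eta2 0.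
    rewrite e0 mulr0; suff -> : A = 0 by rewrite expr0n.
    apply/eqP; rewrite eq_le A0 andbT; apply/ler_addgt0Pl => e ep.
    pose t := Num.min (e / 24) (1 / 2).
    have t0 : 0 < t by rewrite lt_min !divr_gt0.
    have t1 : t < 1 by rewrite gt_min; apply/orP; right; lra.
    have te : t <= e / 24 by rewrite ge_min lexx.
    have := At t t0 t1; rewrite e0 sqr_ge0 => /(_ isT); lra.
  have ep : 0 < eta2 by rewrite lt_def e0.
  have s0 : 0 < Num.sqrt eta2 by rewrite sqrtr_gt0.
  (* Strict because a is nonzero, by the chain rule identity [da]. *)
  have s1 : Num.sqrt eta2 < 1.
    rewrite -[ltRHS]sqrtr1 ltr_sqrt// /eta2 ltrBlDr ltrDl exprn_gt0//.
  have := At _ s0 s1; rewrite sqr_sqrtr// lexx => /(_ isT) h.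
  have -> : 576 * eta2 = (24 * Num.sqrt eta2) ^+ 2.
    by rewrite exprMn sqr_sqrtr//; ring.
  by rewrite ler_pXn2r// nnegrE// mulr_ge0// ltW.
rewrite -[cabs a]ger0_norm ?cabs_ge0// -sqrtr_sqr ler_wsqrtr//.
by move: A2; rewrite /eta2; lra.
Qed.
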